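(* Let $h:[0,\infty)\to[0,\infty)$ be continuous, differentiable on $(0,\infty)$, and such that the limit $h'(0):=\lim_{x\searrow 0}h'(x)$ exists in $[-\infty,\infty)$. Suppose in addition that $h$ is twice differentiable on $(0,\infty)$ with $h''\ge C$ everywhere for some $C\in\mathbb{R}$, and that $\lim_{x\to+\infty}h'(x)=+\infty$. Furthermore, assume that either $h'$ is bounded from below or $\lim_{x\downarrow 0}h'(x)=-\infty$. Let $\mathbb{Q}^*$ be an optimizer of the problem $$\inf\{G_h(\mathbb{Q}) : \mathbb{Q}\in\mathcal{P}(\Omega),\ \mathbb{Q}\in\mathrm{Adm}\},$$ with $G_h(\mathbb{Q}^* )<\infty$ (so that $\mathbb{Q}^*\ll\mathbb{P}$), and fix a version of $\frac{d\mathbb{Q}^*}{d\mathbb{P}}$ with values in $[0,\infty)$. Then there exist sets $\Gamma_{\mathbb{Q}^*},\Gamma_{\mathbb{P}}\subseteq\Omega$ such that $\mathbb{P}(\Gamma_{\mathbb{P}})=\mathbb{Q}^*(\Gamma_{\mathbb{Q}^*})=1$ and, for all competitors $\alpha,\alpha'$ with $\operatorname{supp}(\alpha)\subseteq\Gamma_{\mathbb{Q}^*}$ and $\operatorname{supp}(\alpha')\subseteq\Gamma_{\mathbb{P}}$, we have $$\int h'\Big(\frac{d\mathbb{Q}^*}{d\mathbb{P}}\Big)\,d\alpha\le\int h'\Big(\frac{d\mathbb{Q}^*}{d\mathbb{P}}\Big)\,d\alpha'.$$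
   Context: $\Omega$ is a Polish space with its Borel $\sigma$-algebra, $\mathcal{P}(\Omega)$ is the set of Borel probability measures on $\Omega$, and $\mathbb{P}\in\mathcal{P}(\Omega)$ is fixed. $\mathcal{F}$ is a family of real-valued functions on $\Omega$ such that either (1) $\mathcal{F}$ is a subset of $C_b(\Omega)$, the bounded continuous functions, or (2) $\mathcal{F}$ is a countable family of bounded Borel functions. The admissible set is $\mathrm{Adm}:=\{\mathbb{Q}:\int f\,d\mathbb{Q}=0\ \text{for all } f\in\mathcal{F}\}$. For $\mathbb{Q}\in\mathcal{P}(\Omega)$, $G_h(\mathbb{Q}):=\int_\Omega h\big(\frac{d\mathbb{Q}}{d\mathbb{P}}\big)\,d\mathbb{P}$ if $\mathbb{Q}\ll\mathbb{P}$, and $G_h(\mathbb{Q}):=+\infty$ otherwise. Two positive finite measures $\alpha,\alpha'$ on $\Omega$ with equal total mass and finite support are called competitors if $\int f\,d(\alpha-\alpha')=0$ for all $f\in\mathcal{F}$. At $0$, $h'$ takes the value $h'(0)=\lim_{x\searrow 0}h'(x)\in[-\infty,\infty)$; the integrals in the conclusion are finite sums, possibly with value $-\infty$. *)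

(* Defs.v *)
From HB Require Import structures.
From mathcomp Require Export all_boot all_order all_algebra.
From mathcomp Require Export all_classical all_reals all_analysis.
Export numFieldNormedType.Exports.

Set Implicit Arguments.
Unset Strict Implicit.
Unset Printing Implicit Defensive.

Import Order.TTheory GRing.Theory Num.Theory.

Local Open Scope ring_scope.
Local Open Scope classical_set_scope.

Definition is_metric (R : realType) (T : Type) (d : T -> T -> R) : Prop :=
  [/\ forall x y, 0 <= d x y,
      forall x y, d x y = 0 <-> x = y,
      forall x y, d x y = d y x
    & forall x y z, d x z <= d x y + d y z].

(* Separable and completely metrizable; the metric is not part of the
   structure, only its existence is required. *)
Definition polish_space (R : realType) (T : topologicalType) : Prop :=
  (exists2 S : set T, countable S & dense S) /\
  exists d : T -> T -> R,
    [/\ is_metric d,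
        forall (x : T) (A : set T),
          nbhs x A <-> exists2 e : R, 0 < e & [set y | d x y < e] `<=` A
      & forall u : nat -> T,
          (forall e : R, 0 < e ->
             exists N : nat, forall m n : nat,
               (N <= m)%N -> (N <= n)%N -> d (u m) (u n) < e) ->
          exists l : T, u @ \oo --> l].

Notation borel T := (g_sigma_algebraType (@open T)).

Section Setting.
Context (R : realType) (T : ptopologicalType).

Definition admissible_family (F : set (T -> R)) : Prop :=
  (forall f, F f -> continuous f /\ [bounded f x | x in [set: T]]) \/
  (countable F /\
   forall f, F f -> measurable_fun [set: borel T] (f : borel T -> R) /\
                    [bounded f x | x in [set: T]]).

Definition Adm (F : set (T -> R)) (Q : probability (borel T) R) : Prop :=
  forall f, F f -> (\int[Q]_x (f x)%:E = 0)%E.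

(* The library's derivative is only determined up to a null set and may be
   negative there; since only the values of h on [0, +oo[ are meaningful, it is
   truncated at 0, which does not change its almost-everywhere class. *)
Definition Gh (h : R -> R) (P Q : probability (borel T) R) : \bar R :=
  if `[< Q `<< P >] then
    (\int[P]_x
       (h (Num.max 0 (fine (Radon_Nikodym (charge_of_finite_measure Q) P x))))%:E)%E
  else +oo%E.

Definition optimizer (h : R -> R) (P : probability (borel T) R)
    (F : set (T -> R)) (Q : probability (borel T) R) : Prop :=
  Adm F Q /\
  forall Q' : probability (borel T) R, Adm F Q' -> (Gh h P Q <= Gh h P Q')%E.

Definition RN_version (P Q : probability (borel T) R) (D : borel T -> R) : Prop :=
  [/\ measurable_fun [set: borel T] D,
      forall x, 0 <= D x
    & ae_eq P [set: borel T] (EFin \o D)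
        (Radon_Nikodym (charge_of_finite_measure Q) P)].

Definition msupport (a : {measure set (borel T) -> \bar R}) : set T :=
  [set x : T | forall U : set T, open U -> U x -> (0 < a U)%E].

Definition competitors (F : set (T -> R))
    (a a' : {finite_measure set (borel T) -> \bar R}) : Prop :=
  [/\ a [set: borel T] = a' [set: borel T],
      finite_set (msupport a),
      finite_set (msupport a')
    & forall f, F f ->
        (\int[a]_x (f x)%:E - \int[a']_x (f x)%:E = 0)%E].

End Setting.

(* h', extended to 0 by its right limit, which may be -oo. *)
Definition ederive (R : realType) (h : R -> R) (x : R) : \bar R :=
  if x == 0 then lim ((derive1 h y)%:E @[y --> 0^'+]) else (derive1 h x)%:E.

(* Main.v *)
(* The optimality of [Q], whose density is [D], says that
   [\int[P]_x (phi x * k x) >= 0], with [phi = h' \o D], for every sufficiently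
   small bounded perturbation [k] of [D] which integrates to zero against [F] and
   the constants. By duality between L^1 and L^oo, [phi] is then the limit of
   functions [g_ n] of the space spanned by [F] and the constants in the
   following one-sided sense: the excess [g_ n - phi] tends to [0] almost
   everywhere for [P], and the excess [phi - g_ n] almost everywhere for [Q].
   Competitors give the same integral to [g_ n], so summing over the finite
   supports and letting [n] tend to infinity gives the inequality.
   The duality is obtained by minimizing a weighted Huber functional of
   [g - phi]: its derivatives along a minimizing sequence are bounded and
   converge almost everywhere, to a perturbation [k] which would contradict
   optimality if the infimum were positive.
   Where [D = 0], [phi] may be [-oo]; it is replaced there by constants [c]
   above the right derivative of [h] at [0], with [c --> -oo] in the end. *)
From HB Require Import structures.
Require Import Defs.
From mathcomp Require Import ring lra measurable_realfun.
Set Implicit Arguments.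
Unset Strict Implicit.
Unset Printing Implicit Defensive.
Import Order.TTheory GRing.Theory Num.Theory.
Local Open Scope ring_scope.
Local Open Scope classical_set_scope.

(** * The Huber function *)

Section Huber.
Context {R : realType}.
Implicit Types s t a b e : R.

Definition clamp01 s : R := Num.min 1 (Num.max 0 s).

(** The one-sided Huber function: [0] for [s <= 0], [s ^+ 2 / 2] on [[0, 1]] and [s - 1 / 2] beyond,
    with derivative [clamp01 s]. The boundedness of this derivative is what makes the limiting
    perturbation bounded. *)
Definition huber s : R := clamp01 s ^+ 2 / 2 + Num.max 0 (s - 1).

Lemma clamp01_ge0 s : 0 <= clamp01 s.
Proof. by rewrite le_min ler01 le_max lexx. Qed.

Lemma clamp01_le1 s : clamp01 s <= 1.
Proof. by rewrite ge_min lexx. Qed.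

Lemma huber_ge0 s : 0 <= huber s.
Proof. by rewrite addr_ge0 ?divr_ge0 ?sqr_ge0// le_max lexx. Qed.

(* The Huber function is the infimal convolution of [a ^+ 2 / 2] and
   [Num.max 0 b], made nondecreasing; the decomposition into [clamp01 s] and
   [Num.max 0 (s - 1)] is the optimal one. *)
Lemma huber_le s a b : 0 <= b -> s <= a + b -> huber s <= a ^+ 2 / 2 + b.
Proof.
move=> b0 sab; rewrite /huber /clamp01.
have [s0|s0] := leP s 0.
  rewrite min_r ?ler01// max_l; last by lra.
  by have := sqr_ge0 a; lra.
have [s1|s1] := leP s 1.
  rewrite max_l; last by lra.
  have := sqr_ge0 (a - s).
  have : 0 <= (1 - s) * b by rewrite mulr_ge0// subr_ge0.
  have : 0 <= s * (a + b - s) by rewrite mulr_ge0 ?(ltW s0)// subr_ge0.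
  nra.
rewrite max_r; last by lra.
by have := sqr_ge0 (a - 1); nra.
Qed.

Lemma huber_le_sqr s : huber s <= s ^+ 2 / 2.
Proof. by rewrite -[leRHS]addr0 huber_le// addr0. Qed.

Lemma le_clamp01 s : s <= clamp01 s + Num.max 0 (s - 1).
Proof.
by rewrite /clamp01 /Num.min /Num.max; do ?case: ifPn; rewrite -?leNgt; lra.
Qed.

(** Apply [huber_le] to the optimal decomposition of [s], scaled by [1 - t], with [t * s'] charged
    entirely to the quadratic part. The cross term carries the derivative [clamp01 s], and the error
    is quadratic in [s'] alone. *)
Lemma huber_descent s s' t : 0 <= t <= 1 ->
  huber ((1 - t) * s + t * s') <=
  (1 - t) * huber s + t * (1 - t) * (clamp01 s * s') + t ^+ 2 * (s' ^+ 2 / 2).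
Proof.
move=> /andP[t0 t1]; have sc := le_clamp01 s.
rewrite (le_trans (@huber_le _ ((1 - t) * clamp01 s + t * s')
  ((1 - t) * Num.max 0 (s - 1)) _ _))//.
- by rewrite mulr_ge0 ?subr_ge0// le_max lexx.
- have : 0 <= 1 - t by rewrite subr_ge0.
  by nra.
- rewrite /huber.
  have : 0 <= t * (1 - t) * clamp01 s ^+ 2.
    by rewrite mulr_ge0 ?sqr_ge0// mulr_ge0// subr_ge0.
  by nra.
Qed.

(** Averaging the optimal decompositions of [s] and [t] decomposes the midpoint, and the
    parallelogram identity for the quadratic parts yields the gain. Strict convexity is thus
    measured by the derivatives, not by [s - t]. *)
Lemma huber_midpoint s t :
  huber (2^-1 * s + 2^-1 * t) + (clamp01 s - clamp01 t) ^+ 2 / 8 <=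
  2^-1 * huber s + 2^-1 * huber t.
Proof.
have sc := le_clamp01 s; have tc := le_clamp01 t.
have := @huber_le (2^-1 * s + 2^-1 * t) (2^-1 * clamp01 s + 2^-1 * clamp01 t)
  (2^-1 * Num.max 0 (s - 1) + 2^-1 * Num.max 0 (t - 1)).
have sm : 0 <= Num.max 0 (s - 1) by rewrite le_max lexx.
have tm : 0 <= Num.max 0 (t - 1) by rewrite le_max lexx.
rewrite /huber; move=> /(_ _ _)/le_trans H.
rewrite -lerBrDr; apply: H; [lra|lra|].
nra.
Qed.

Lemma huber_lt s e : 0 < e <= 1 -> huber s < e ^+ 2 / 2 -> s < e.
Proof.
move=> /andP[e0 e1]; rewrite [in X in _ -> X]ltNge; apply: contraTN => es.
rewrite -leNgt.
have ec : e <= clamp01 s by rewrite le_min e1 le_max es orbT.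
rewrite -[leLHS]addr0 lerD ?le_max ?lexx// ler_pM2r ?invr_gt0//.
by rewrite ler_sqr// nnegrE ?clamp01_ge0// ltW.
Qed.

(** The weight [p] penalizes positive values and [q] negative ones. Taking [q = 0] removes all
    control from below, as is needed where the density vanishes. *)
Definition whuber p q s : R := p * huber s + q * huber (- s).

(* the derivative of [whuber p q] *)
Definition wclamp p q s : R := p * clamp01 s - q * clamp01 (- s).

Lemma whuber_ge0 p q s : 0 <= p -> 0 <= q -> 0 <= whuber p q s.
Proof. by move=> p0 q0; rewrite addr_ge0// mulr_ge0// huber_ge0. Qed.

Lemma whuber_le p q s : 0 <= p -> 0 <= q ->
  whuber p q s <= (p + q) * (s ^+ 2 / 2).
Proof.
move=> p0 q0; rewrite mulrDl lerD// ler_wpM2l//; first exact: huber_le_sqr.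
by rewrite -(sqrrN s) huber_le_sqr.
Qed.

Lemma wclamp_bound p q s : 0 <= p -> 0 <= q -> - q <= wclamp p q s <= p.
Proof.
move=> p0 q0; rewrite /wclamp.
have := clamp01_ge0 s; have := clamp01_le1 s.
have := clamp01_ge0 (- s); have := clamp01_le1 (- s) => *; apply/andP; split; nra.
Qed.

Lemma whuber_descent p q s s' t : 0 <= p -> 0 <= q -> 0 <= t <= 1 ->
  whuber p q ((1 - t) * s + t * s') <=
  (1 - t) * whuber p q s + t * (1 - t) * (wclamp p q s * s')
  + t ^+ 2 * ((p + q) * (s' ^+ 2 / 2)).
Proof.
move=> p0 q0 t01.
have := ler_wpM2l p0 (huber_descent s s' t01).
have := ler_wpM2l q0 (huber_descent (- s) (- s') t01).
rewrite /whuber /wclamp.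
rewrite (_ : - ((1 - t) * s + t * s') = (1 - t) * - s + t * - s'); last by ring.
by move=> H1 H2; rewrite (le_trans (lerD H2 H1))// le_eqVlt; apply/orP; left;
  apply/eqP; field.
Qed.

Lemma whuber_midpoint p q s t : 0 <= p <= 1 -> 0 <= q <= 1 ->
  whuber p q (2^-1 * s + 2^-1 * t) + (wclamp p q s - wclamp p q t) ^+ 2 / 16 <=
  2^-1 * whuber p q s + 2^-1 * whuber p q t.
Proof.
move=> /andP[p0 p1] /andP[q0 q1].
have := ler_wpM2l p0 (huber_midpoint s t).
have := ler_wpM2l q0 (huber_midpoint (- s) (- t)).
rewrite /whuber /wclamp.
rewrite (_ : - (2^-1 * s + 2^-1 * t) = 2^-1 * - s + 2^-1 * - t); last by ring.
set cs := clamp01 s; set ct := clamp01 t.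
set ds := clamp01 (- s); set dt := clamp01 (- t).
move=> H1 H2.
have {H1 H2} := lerD H2 H1.
(* The constant passes from 8 to 16 by the bound of [(a - b) ^+ 2] by [2 * a ^+ 2 + 2 * b ^+ 2];
   weights at most 1 satisfy [p ^+ 2 <= p]. *)
have H : (p * cs - q * ds - (p * ct - q * dt)) ^+ 2 / 16 <=
   p * ((cs - ct) ^+ 2 / 8) + q * ((ds - dt) ^+ 2 / 8).
  have : 0 <= (p * (cs - ct) + q * (ds - dt)) ^+ 2 by exact: sqr_ge0.
  have : p ^+ 2 * (cs - ct) ^+ 2 <= p * (cs - ct) ^+ 2.
    by rewrite ler_wpM2r ?sqr_ge0// expr2 ler_piMl.
  have : q ^+ 2 * (ds - dt) ^+ 2 <= q * (ds - dt) ^+ 2.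
    by rewrite ler_wpM2r ?sqr_ge0// expr2 ler_piMl.
  by nra.
by move: H; lra.
Qed.

End Huber.

Lemma measurable_clamp01 {R : realType} : measurable_fun [set: R] (@clamp01 R).
Proof.
by apply: measurable_minr => //; apply: measurable_maxr.
Qed.

Lemma measurable_huber {R : realType} : measurable_fun [set: R] (@huber R).
Proof.
apply: measurable_funD.
  apply: measurable_funM => //; apply: measurable_funX.
  exact: measurable_clamp01.
by apply: measurable_maxr => //; apply: measurable_funB.
Qed.

(** * Bounded measurable functions *)

Definition bmeas {d} {T : measurableType d} {R : realType} (f : T -> R) :=
  measurable_fun [set: T] f /\ exists M, forall x, `|f x| <= M.

Section bmeas.
Context {d : measure_display} {T : measurableType d} {R : realType}.
Variable mu : {finite_measure set T -> \bar R}.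
Implicit Types f g : T -> R.

Lemma bmeas_cst (c : R) : bmeas (fun _ : T => c).
Proof. by split=> //; exists `|c|. Qed.

Lemma bmeasD f g : bmeas f -> bmeas g -> bmeas (fun x => f x + g x).
Proof.
move=> [mf [M fM]] [mg [N gN]]; split; first exact: measurable_funD.
by exists (M + N) => x; rewrite (le_trans (ler_normD _ _))// lerD.
Qed.

Lemma bmeasM f g : bmeas f -> bmeas g -> bmeas (fun x => f x * g x).
Proof.
move=> [mf [M fM]] [mg [N gN]]; split; first exact: measurable_funM.
by exists (M * N) => x; rewrite normrM ler_pM.
Qed.

Lemma bmeasZ c f : bmeas f -> bmeas (fun x => c * f x).
Proof. by apply: bmeasM; exact: bmeas_cst. Qed.

Lemma bmeasN f : bmeas f -> bmeas (fun x => - f x).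
Proof.
move=> /(bmeasZ (-1)); congr (bmeas _); apply/funext => x.
by rewrite mulN1r.
Qed.

Lemma bmeasB f g : bmeas f -> bmeas g -> bmeas (fun x => f x - g x).
Proof. by move=> bf bg; apply: bmeasD => //; exact: bmeasN. Qed.

Lemma bmeas_norm f : bmeas f -> bmeas (fun x => `|f x|).
Proof.
move=> [mf [M fM]]; split; first exact: measurableT_comp.
by exists M => x; rewrite normr_id.
Qed.

Lemma bmeas_bounded f : measurable_fun [set: T] f ->
  [bounded f x | x in [set: T]] -> bmeas f.
Proof.
move=> mf [M [_ fM]]; split => //; exists (`|M| + 1) => x.
by apply: fM => //; rewrite ltr_pwDr// ler_norm.
Qed.

Lemma bmeas_integrable f : bmeas f -> mu.-integrable [set: T] (EFin \o f).
Proof.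
move=> [mf [M fM]]; apply: measurable_bounded_integrable => //.
  by rewrite fin_num_fun_lty//; exact: fin_num_measure.
by exists M; split; [exact: num_real|move=> x Mx y _; exact: le_trans (ltW Mx)].
Qed.

Lemma EFin_Rintegral f : bmeas f ->
  (\int[mu]_x f x)%:E = (\int[mu]_x (f x)%:E)%E.
Proof.
move=> bf; rewrite fineK//; apply: integrable_fin_num => //.
exact: bmeas_integrable.
Qed.

Lemma bmeas_RintegralD f g : bmeas f -> bmeas g ->
  \int[mu]_x (f x + g x) = \int[mu]_x f x + \int[mu]_x g x.
Proof. by move=> bf bg; rewrite RintegralD//; exact: bmeas_integrable. Qed.

Lemma bmeas_RintegralB f g : bmeas f -> bmeas g ->
  \int[mu]_x (f x - g x) = \int[mu]_x f x - \int[mu]_x g x.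
Proof. by move=> bf bg; rewrite RintegralB//; exact: bmeas_integrable. Qed.

Lemma bmeas_RintegralZ c f : bmeas f ->
  \int[mu]_x (c * f x) = c * \int[mu]_x f x.
Proof. by move=> bf; rewrite RintegralZl//; exact: bmeas_integrable. Qed.

Lemma bmeas_le_Rintegral f g : bmeas f -> bmeas g -> (forall x, f x <= g x) ->
  \int[mu]_x f x <= \int[mu]_x g x.
Proof. by move=> bf bg fg; apply: le_Rintegral => //; exact: bmeas_integrable. Qed.

Lemma bmeas_dominated (f_ : nat -> T -> R) f M :
  (forall n, measurable_fun [set: T] (f_ n)) -> measurable_fun [set: T] f ->
  (forall n x, `|f_ n x| <= M) ->
  {ae mu, forall x, f_ ^~ x @ \oo --> f x} ->
  \int[mu]_x f_ n x @[n --> \oo] --> \int[mu]_x f x.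
Proof.
move=> mf_ mf f_M f_f.
have [] := @dominated_convergence _ _ _ mu setT measurableT
  (fun n x => (f_ n x)%:E) (EFin \o f) (cst M%:E).
- by move=> n; exact/measurable_EFinP.
- exact/measurable_EFinP.
- by apply: filterS f_f => x f_f _; by apply: cvg_EFin; [exact: nearW|exact: f_f].
- exact: bmeas_integrable (bmeas_cst M).
- by apply: aeW => x n _; rewrite lee_fin.
move=> fi _ H; apply: fine_cvg; rewrite fineK//.
exact: integrable_fin_num.
Qed.

(** By monotone convergence the sum of the series has integral at most [2 * A], so it is finite
    almost everywhere. *)
Lemma ae_cvg_series (f_ : nat -> T -> R) A :
  (forall n, bmeas (f_ n)) -> (forall n x, 0 <= f_ n x) ->
  (forall n, \int[mu]_x f_ n x <= A / 2 ^+ n) ->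
  {ae mu, forall x, cvgn (series (f_ ^~ x))}.
Proof.
move=> bf f0 intf.
have A0 : 0 <= A.
  have := intf 0%N; rewrite expr0 divr1; apply: le_trans.
  exact: Rintegral_ge0.
pose F x := (\sum_(n <oo) (f_ n x)%:E)%E.
have F0 x : (0 <= F x)%E by apply: nneseries_ge0 => n _ _; rewrite lee_fin.
have mF : measurable_fun [set: T] F.
  apply: ge0_emeasurable_sum => //.
    by move=> n x _ _; rewrite lee_fin.
  by move=> n _; apply/measurable_EFinP; have [] := bf n.
have iF : mu.-integrable [set: T] F.
  apply/integrableP; split => //.
  under eq_integral do rewrite gee0_abs//.
  rewrite integral_nneseries//; last 2 first.
    by move=> n; apply/measurable_EFinP; have [] := bf n.
    by move=> n x _; rewrite lee_fin.
  rewrite (@le_lt_trans _ _ (2 * A)%:E) ?ltry//.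
  apply: le_trans (@epsilon_trick0 _ (2 * A) xpredT _); last first.
    by rewrite mulr_ge0.
  apply: lee_nneseries => [n _ _|n _].
    by apply: integral_ge0 => x _; rewrite lee_fin.
  rewrite -EFin_Rintegral// lee_fin (le_trans (intf n))//.
  by rewrite natrX exprS invfM mulrACA divff// mul1r.
have := integrable_ae measurableT iF; apply: filterS => x /(_ I) Fx.
apply: nondecreasing_is_cvgn.
  apply/nondecreasing_seqP => n; rewrite /series/= big_nat_recr//=.
  by rewrite lerDl.
exists (fine (F x)) => _ [n _ <-].
rewrite -lee_fin fineK// /series/= -sumEFin; apply: nneseries_lim_ge => k _ _.
by rewrite lee_fin.
Qed.

End bmeas.

(** * One-sided approximation by duality *)

Section duality.
Context {d : measure_display} {T : measurableType d} {R : realType}.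
Variable mu : {finite_measure set T -> \bar R}.
Variable V : set (T -> R).
Hypothesis bV : forall g, V g -> bmeas g.
Hypothesis V0 : V (fun=> 0).
Hypothesis VD : forall a b f g, V f -> V g -> V (fun x => a * f x + b * g x).
Variables phi p q : T -> R.
Hypothesis mphi : measurable_fun [set: T] phi.
Hypothesis mp : measurable_fun [set: T] p.
Hypothesis mq : measurable_fun [set: T] q.
Hypothesis p01 : forall x, 0 <= p x <= 1.
Hypothesis q01 : forall x, 0 <= q x <= 1.
Hypothesis pphi : forall x, p x * phi x ^+ 2 <= 1.
Hypothesis qphi : forall x, q x * phi x ^+ 2 <= 1.

Let p0 x : 0 <= p x. Proof. by have /andP[] := p01 x. Qed.
Let q0 x : 0 <= q x. Proof. by have /andP[] := q01 x. Qed.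
Let p1 x : p x <= 1. Proof. by have /andP[] := p01 x. Qed.
Let q1 x : q x <= 1. Proof. by have /andP[] := q01 x. Qed.

(** [K g] is the derivative of the integrand [W g] of the functional [J]. As [p * phi ^+ 2] and
    [q * phi ^+ 2] are at most 1, [W g] is bounded for bounded [g] even when [phi] is not. *)
Let W g x := whuber (p x) (q x) (g x - phi x).
Let K g x := wclamp (p x) (q x) (g x - phi x).
Let J g := \int[mu]_x W g x.

Let bsqr g : bmeas g ->
  bmeas (fun x => (p x + q x) * ((g x - phi x) ^+ 2 / 2)).
Proof.
move=> [mg [M gM]]; split.
  apply: measurable_funM; first exact: measurable_funD.
  by apply: measurable_funM => //; apply: measurable_funX; exact: measurable_funB.
exists (2 * M ^+ 2 + 2) => x; rewrite ger0_norm; last first.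
  by rewrite mulr_ge0 ?addr_ge0// divr_ge0// sqr_ge0.
have : (g x - phi x) ^+ 2 / 2 <= g x ^+ 2 + phi x ^+ 2.
  by have := sqr_ge0 (g x + phi x); lra.
have gM2 : g x ^+ 2 <= M ^+ 2.
  by rewrite -(real_normK (num_real (g x))) ler_pXn2r ?nnegrE// (le_trans _ (gM x)).
move=> /(ler_wpM2l (addr_ge0 (p0 x) (q0 x)))/le_trans; apply.
have := p0 x; have := q0 x; have := p1 x; have := q1 x.
have := pphi x; have := qphi x; have := sqr_ge0 (g x).
by nra.
Qed.

Let mwhuber g : measurable_fun [set: T] g -> measurable_fun [set: T] (W g).
Proof.
move=> mg; have mgp : measurable_fun [set: T] (fun x => g x - phi x).
  exact: measurable_funB.
apply: measurable_funD; apply: measurable_funM => //.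
  exact: (measurableT_comp measurable_huber).
by apply: (measurableT_comp measurable_huber); exact: measurable_funN.
Qed.

Let mwclamp g : measurable_fun [set: T] g -> measurable_fun [set: T] (K g).
Proof.
move=> mg; have mgp : measurable_fun [set: T] (fun x => g x - phi x).
  exact: measurable_funB.
apply: measurable_funB; apply: measurable_funM => //.
  exact: (measurableT_comp measurable_clamp01).
by apply: (measurableT_comp measurable_clamp01); exact: measurable_funN.
Qed.

Let bW g : bmeas g -> bmeas (W g).
Proof.
move=> bg; have [_ [M gM]] := bsqr bg; have [mg _] := bg.
split; first exact: mwhuber.
exists M => x; rewrite ger0_norm ?whuber_ge0//.
by rewrite (le_trans _ (gM x))// (le_trans _ (ler_norm _))// whuber_le.
Qed.

Let bphi k : measurable_fun [set: T] k -> (forall x, - q x <= k x <= p x) ->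
  bmeas (fun x => phi x * k x).
Proof.
move=> mk kpq; split; first exact: measurable_funM.
(* The product is at most [(1 + phi x ^+ 2) * (p x + q x)], where each of the four terms is at most
   1. *)
exists 4 => x; rewrite normrM.
have : `|phi x| <= 1 + phi x ^+ 2.
  rewrite -(real_normK (num_real (phi x))).
  by have := sqr_ge0 (`|phi x| - 1); have := normr_ge0 (phi x); nra.
have : `|k x| <= p x + q x.
  have /andP[k1 k2] := kpq x; have := p0 x; have := q0 x.
  by rewrite ler_norml => *; apply/andP; split; lra.
move=> h1 h2; rewrite (le_trans (ler_pM _ _ h2 h1))//.
have := p0 x; have := q0 x; have := p1 x; have := q1 x.
have := pphi x; have := qphi x.
by nra.
Qed.

Let bk k : measurable_fun [set: T] k -> (forall x, - q x <= k x <= p x) ->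
  bmeas k.
Proof.
move=> mk kpq; split => //; exists 1 => x.
have /andP[k1 k2] := kpq x; have := p1 x; have := q1 x.
by rewrite ler_norml => *; apply/andP; split; lra.
Qed.

Let bK g : bmeas g -> bmeas (K g).
Proof.
by move=> [mg _]; apply: bk => [|x]; [exact: mwclamp|exact: wclamp_bound].
Qed.

Let J_ge0 g : 0 <= J g.
Proof. by apply: Rintegral_ge0 => x _; exact: whuber_ge0. Qed.

Let delta := inf (J @` V).

Let has_infJ : has_inf (J @` V).
Proof. by split; [exists (J (fun=> 0)), (fun=> 0)|exists 0 => _ [g _ <-]]. Qed.

Let delta_ge0 : 0 <= delta.
Proof. by apply: lb_le_inf; [case: has_infJ|move=> _ [g _ <-]]. Qed.

Let delta_le g : V g -> delta <= J g.
Proof. by move=> Vg; apply: ge_inf; [case: has_infJ|exists g]. Qed.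

(** The midpoint of [f] and [g] lies in [V], so its functional is at least [delta]. Hence
    near-minimizers have derivatives that are close in L^2. *)
Let J_midpoint f g : V f -> V g ->
  delta + \int[mu]_x ((K f x - K g x) ^+ 2) / 16 <= 2^-1 * J f + 2^-1 * J g.
Proof.
move=> Vf Vg; have bf := bV Vf; have bg := bV Vg.
have bm : bmeas (fun x => 2^-1 * f x + 2^-1 * g x) by apply: bV; exact: VD.
have bK2 : bmeas (fun x => 16^-1 * (K f x - K g x) ^+ 2).
  by apply: bmeasZ; apply: bmeasM; apply: bmeasB; exact: bK.
rewrite mulrC -bmeas_RintegralZ; last first.
  by apply: bmeasM; apply: bmeasB; exact: bK.
rewrite -!bmeas_RintegralZ; [|exact: bW..].
rewrite -bmeas_RintegralD; [|by apply: bmeasZ; exact: bW..].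
apply: le_trans (_ : J (fun x => 2^-1 * f x + 2^-1 * g x) +
  \int[mu]_x (16^-1 * (K f x - K g x) ^+ 2) <= _).
  by rewrite lerD2r delta_le//; exact: VD.
rewrite -bmeas_RintegralD//; last exact: bW.
apply: bmeas_le_Rintegral => [||x].
- by apply: bmeasD => //; exact: bW.
- by apply: bmeasD; apply: bmeasZ; exact: bW.
- have := @whuber_midpoint _ (p x) (q x) (f x - phi x) (g x - phi x) (p01 x) (q01 x).
  rewrite /W /K [_ * 16^-1]mulrC; congr (whuber _ _ _ + _ <= _); lra.
Qed.

(* The minimizing sequence is perturbed towards a fixed [g]: no control on the
   size of [f] enters the quadratic error term. *)
Let J_descent f g t : V f -> V g -> 0 <= t <= 1 ->
  delta <= (1 - t) * J f + t * (1 - t) * \int[mu]_x (K f x * (g x - phi x))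
    + t ^+ 2 * \int[mu]_x ((p x + q x) * ((g x - phi x) ^+ 2 / 2)).
Proof.
move=> Vf Vg t01; have bf := bV Vf; have bg := bV Vg.
have bKg : bmeas (fun x => K f x * (g x - phi x)).
  rewrite [X in bmeas X](_ : _ = (fun x => K f x * g x - phi x * K f x)).
    apply: bmeasB; first by apply: bmeasM => //; exact: bK.
    by apply: bphi => [|x]; [apply: mwclamp; case: bf|exact: wclamp_bound].
  by apply/funext => x; ring.
rewrite -!bmeas_RintegralZ//; do ?[exact: bsqr|exact: bW].
rewrite -!bmeas_RintegralD//; first last.
- exact: bmeasZ.
- by apply: bmeasZ; exact: bW.
- by apply: bmeasZ; exact: bsqr.
- by apply: bmeasD; [apply: bmeasZ; exact: bW|exact: bmeasZ].
rewrite (le_trans (@delta_le (fun x => (1 - t) * f x + t * g x) _))//.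
  exact: VD.
apply: bmeas_le_Rintegral => [||x].
- by apply/bW/bV; exact: VD.
- apply: bmeasD; last by apply: bmeasZ; exact: bsqr.
  by apply: bmeasD; [apply: bmeasZ; exact: bW|exact: bmeasZ].
- have := @whuber_descent _ _ _ (f x - phi x) (g x - phi x) _ (p0 x) (q0 x) t01.
  by rewrite /W /K; congr (whuber _ _ _ <= _); ring.
Qed.

(* [orth_ge0] is the dual statement: no bounded perturbation orthogonal to [V]
   decreases the integral of [phi]. *)
Hypothesis orth_ge0 : forall k, measurable_fun [set: T] k ->
  (forall x, - q x <= k x <= p x) ->
  (forall g, V g -> \int[mu]_x (g x * k x) = 0) ->
  0 <= \int[mu]_x (phi x * k x).

Lemma ae_approximation : exists2 g_ : nat -> T -> R, (forall n, V (g_ n)) &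
  {ae mu, forall x, whuber (p x) (q x) (g_ n x - phi x) @[n --> \oo] --> 0}.
Proof.
pose e n : R := (2 ^+ n)^-1.
have e0 n : 0 < e n by rewrite invr_gt0 exprn_gt0.
have e1 n : e n <= 1.
  by rewrite invf_le1 ?exprn_gt0// exprn_ege1// ler1n.
have eS n : e n.+1 <= e n.
  by rewrite lef_pV2 ?posrE ?exprn_gt0// ler_eXn2l// ltr1n.
(* The cubic rate leaves room for the passage from L^2 to L^1 below, which costs a factor
   [(e n)^-1]. *)
have /choice[g_ g_P] n : exists g, V g /\ J g < delta + e n ^+ 3.
  have e3 : 0 < e n ^+ 3 by rewrite exprn_gt0.
  by have [_ [g Vg <-] Jg] := inf_adherent e3 has_infJ; exists g.
have Vg n : V (g_ n) by have [] := g_P n.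
have Jg n : J (g_ n) <= delta + e n ^+ 3 by apply: ltW; have [] := g_P n.
exists g_ => //.
have bg n : bmeas (g_ n) by exact: bV.
pose m := \int[mu]_x (1 : R).
have m0 : 0 <= m by exact: Rintegral_ge0.
have Kcvg : {ae mu, forall x, cvgn (fun n => K (g_ n) x)}.
  have bKK n : bmeas (fun x => K (g_ n.+1) x - K (g_ n) x).
    by apply: bmeasB; exact: bK.
  have := @ae_cvg_series _ _ _ mu (fun n x => `|K (g_ n.+1) x - K (g_ n) x|)
    (m + 16).
  case/(_ _ _ _)/Wrap => // [n|n|].
  - exact: bmeas_norm.
  - have KK2 : \int[mu]_x ((K (g_ n.+1) x - K (g_ n) x) ^+ 2) <= 16 * e n ^+ 3.
      have := J_midpoint (Vg n.+1) (Vg n).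
      have : e n.+1 ^+ 3 <= e n ^+ 3 by rewrite ler_pXn2r// nnegrE ltW.
      by have := Jg n; have := Jg n.+1; lra.
    have bKK2 : bmeas (fun x => (K (g_ n.+1) x - K (g_ n) x) ^+ 2).
      exact: bmeasM.
    (* Pointwise [z <= e n + (e n)^-1 * z ^+ 2], so the L^1 distance of consecutive derivatives is
       at most [m * e n + 16 * e n ^+ 2], which is summable. *)
    apply: (@le_trans _ _ (\int[mu]_x
        (e n * 1 + (e n)^-1 * (K (g_ n.+1) x - K (g_ n) x) ^+ 2))).
      apply: bmeas_le_Rintegral => [||x].
      - exact: bmeas_norm.
      - by apply: bmeasD; apply: bmeasZ => //; exact: bmeas_cst.
      - rewrite mulr1 -(real_normK (num_real (K _ _ - _))).
        rewrite -(ler_pM2l (e0 n)) mulrDr mulVKf ?gt_eqF//.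
        set z := `|_|; have := sqr_ge0 (e n - z); have := sqr_ge0 z.
        by have := sqr_ge0 (e n); lra.
    rewrite bmeas_RintegralD; [|apply: bmeasZ; exact: bmeas_cst|exact: bmeasZ].
    rewrite !bmeas_RintegralZ//; last exact: bmeas_cst.
    have : (e n)^-1 * \int[mu]_x ((K (g_ n.+1) x - K (g_ n) x) ^+ 2)
           <= (e n)^-1 * (16 * e n ^+ 3).
      by rewrite ler_pM2l// invr_gt0.
    rewrite (_ : (e n)^-1 * (16 * e n ^+ 3) = 16 * e n ^+ 2); last first.
      by field; rewrite gt_eqF.
    rewrite -/(e n) -/m.
    have : e n ^+ 2 <= e n by rewrite expr2 ler_piMl// ltW.
    by have := e0 n; nra.
  apply: filterS => x cx.
  have : cvgn (series (telescope (fun n => K (g_ n) x))) by exact: normed_cvg.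
  rewrite telescopeK => /cvg_ex[l lx]; apply/cvg_ex; exists (l + K (g_ 0%N) x).
  rewrite [X in X @ _ --> _](_ : _ =
    (fun n => (K (g_ n) x - K (g_ 0%N) x) + K (g_ 0%N) x)).
    by apply: cvgD => //; exact: cvg_cst.
  by apply/funext => n; rewrite subrK.
(* The upper limit makes [k] measurable, and the truncation makes the bounds [- q x] and [p x] hold
   at every point rather than almost everywhere. Neither changes the limit where it exists. *)
pose k x := Num.max (- q x) (Num.min (p x) (limn_sup (fun n => K (g_ n) x))).
have Kpq n x : - q x <= K (g_ n) x <= p x by exact: wclamp_bound.
have mk : measurable_fun [set: T] k.
  apply: measurable_maxr; first exact: measurable_funN.
  apply: measurable_minr => //; apply: measurable_fun_limn_sup.
  - move=> x _; exists (p x) => _ [n _ <-].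
    by have /andP[] := Kpq n x.
  - move=> x _; exists (- q x) => _ [n _ <-].
    by have /andP[] := Kpq n x.
  - by move=> n; apply: mwclamp; case: (bg n).
have kpq x : - q x <= k x <= p x.
  rewrite /k le_max lexx/= ge_max ge_min lexx/= andbT.
  by rewrite (le_trans _ (p0 x))// oppr_le0.
have Kk : {ae mu, forall x, K (g_ n) x @[n --> \oo] --> k x}.
  apply: filterS Kcvg => x cx.
  suff -> : k x = limn (fun n => K (g_ n) x) by [].
  rewrite /k cvg_limn_supE// min_r ?max_r//.
    apply: limr_ge => //; apply: nearW => n; by have /andP[] := Kpq n x.
  by apply: limr_le => //; apply: nearW => n; have /andP[] := Kpq n x.
have Jcvg : J (g_ n) @[n --> \oo] --> delta.
  apply: (@squeeze_cvgr _ _ _ _ (cst delta) (fun n => delta + e n)).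
  - apply: nearW => n; rewrite delta_le//= (le_trans (Jg n))// lerD2l.
    by rewrite exprS ler_piMr ?(ltW (e0 n))// exprn_ile1// ltW.
  - exact: cvg_cst.
  - rewrite -[X in _ --> X]addr0; apply: cvgD; first exact: cvg_cst.
    rewrite [X in X @ _ --> _](_ : _ = (fun n => (2^-1 : R) ^+ n)).
      by apply: cvg_expr; rewrite ger0_norm// invf_lt1// ltr1n.
    by apply/funext => n; rewrite exprVn.
have bkg g : V g -> bmeas (fun x => k x * (g x - phi x)).
  move=> /bV Vg'; rewrite [X in bmeas X](_ : _ = (fun x => k x * g x - phi x * k x)).
    by apply: bmeasB; [apply: bmeasM => //; exact: bk|exact: bphi].
  by apply/funext => x; ring.
have Kg_cvg g : V g -> \int[mu]_x (K (g_ n) x * (g x - phi x)) @[n --> \oo] -->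
    \int[mu]_x (k x * (g x - phi x)).
  move=> Vg'; have [_ [M sM]] := bsqr (bV Vg'); have [mg _] := bV Vg'.
  apply: (@bmeas_dominated _ _ _ mu _ _ (2 + M)) => //.
  - move=> n; apply: measurable_funM; last exact: measurable_funB.
    by apply: mwclamp; case: (bg n).
  - by case: (bkg _ Vg').
  - move=> n x; rewrite normrM.
    have : `|g x - phi x| <= 1 + (g x - phi x) ^+ 2 / 2.
      rewrite -(real_normK (num_real (g x - phi x))).
      by have := sqr_ge0 (`|g x - phi x| - 1); lra.
    have : `|K (g_ n) x| <= p x + q x.
      have /andP[k1 k2] := Kpq n x; have := p0 x; have := q0 x.
      by rewrite ler_norml => *; apply/andP; split; lra.
    move=> h1 h2; rewrite (le_trans (ler_pM _ _ h1 h2))//.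
    have := le_trans (ler_norm _) (sM x).
    have := p1 x; have := q1 x.
    by lra.
  - apply: filterS Kk => x; move=> Kk; apply: cvgM => //; exact: cvg_cst.
(* This is the variational inequality at the infimum: let [n] tend to infinity in [J_descent], then
   compare first-order terms for small [t]. *)
have key g : V g -> delta <= \int[mu]_x (k x * (g x - phi x)).
  move=> Vg'; set L := \int[mu]_x _.
  set A := \int[mu]_x ((p x + q x) * ((g x - phi x) ^+ 2 / 2)).
  have H t : 0 <= t <= 1 -> delta <= (1 - t) * delta + t * (1 - t) * L + t ^+ 2 * A.
    move=> t01.
    have cv : (1 - t) * J (g_ n) + t * (1 - t) *
       \int[mu]_x (K (g_ n) x * (g x - phi x)) + t ^+ 2 * A @[n --> \oo] -->
       (1 - t) * delta + t * (1 - t) * L + t ^+ 2 * A.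
      apply: cvgD; last exact: cvg_cst.
      apply: cvgD; apply: cvgM => //; try exact: cvg_cst.
      exact: Kg_cvg.
    rewrite -(cvg_lim _ cv)//; apply: limr_ge; first by apply/cvg_ex; eexists; exact: cv.
    by apply: nearW => n; exact: J_descent.
  rewrite leNgt; apply/negP => Ld.
  (* If [L < delta], then [c] exceeds [|A - L|], so this [t] satisfies [t * (A - L) < delta - L],
     and the inequality [H t] fails. *)
  pose c := delta - L + `|A - L| + 1; pose t := (delta - L) / c.
  have c0 : 0 < c by rewrite /c; have := normr_ge0 (A - L); lra.
  have t0 : 0 < t by rewrite divr_gt0// subr_gt0.
  have t1 : t <= 1.
    by rewrite ler_pdivrMr// mul1r /c; have := normr_ge0 (A - L); lra.
  have := H t; rewrite t1 (ltW t0) => /(_ isT).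
  have tc : t * c = delta - L by rewrite /t divfK// gt_eqF.
  have : t * (A - L) <= t * `|A - L| by rewrite ler_pM2l// ler_norm.
  move: tc; rewrite /c => tc tA.
  apply/negP; rewrite -ltNge -subr_gt0.
  rewrite (_ : _ - _ = t * (delta - L - t * (A - L))); last by ring.
  rewrite mulr_gt0//; nra.
(* By [key] on all multiples of [g], an affine function of the scalar is bounded below by [delta],
   so its slope is zero. The scalar chosen below would otherwise give it the value [delta - 1]. *)
have kg0 g : V g -> \int[mu]_x (g x * k x) = 0.
  move=> Vg'; have bg' := bV Vg'.
  have eq c : \int[mu]_x (k x * (c * g x - phi x)) =
              c * \int[mu]_x (g x * k x) - \int[mu]_x (phi x * k x).
    have bgk : bmeas (fun x => g x * k x) by apply: bmeasM => //; exact: bk.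
    rewrite -bmeas_RintegralZ// -bmeas_RintegralB//; last 2 first.
    - exact: bmeasZ.
    - exact: bphi.
    by apply: eq_Rintegral => x _; ring.
  apply/eqP/negPn/negP => a0.
  have := key (fun x => ((\int[mu]_x (phi x * k x) + delta - 1) /
    \int[mu]_x (g x * k x)) * g x).
  rewrite eq divfK// => /(_ _)/Wrap[|]; last by lra.
  have := VD ((\int[mu]_x (phi x * k x) + delta - 1) /
    \int[mu]_x (g x * k x)) 0 Vg' Vg'.
  by congr (V _); apply/funext => x; rewrite mul0r addr0.
(* Now [k] is orthogonal to [V], so [orth_ge0] applies, and [key] at the zero function bounds
   [delta] by minus a nonnegative integral. *)
have delta0 : delta = 0.
  apply/le_anti; rewrite delta_ge0 andbT.
  have := key _ V0.
  rewrite (_ : \int[mu]_x (k x * (0 - phi x)) = - \int[mu]_x (phi x * k x)).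
    by have := orth_ge0 mk kpq kg0; lra.
  rewrite -mulN1r -bmeas_RintegralZ; last exact: bphi.
  by apply: eq_Rintegral => x _; ring.
(* With [delta = 0] the integrals of [W (g_ n)] are summable, so the whole sequence converges almost
   everywhere, without extraction. *)
have := @ae_cvg_series _ _ _ mu (fun n => W (g_ n)) 1.
case/(_ _ _ _)/Wrap => // [n|n x|n|].
- exact: bW.
- exact: whuber_ge0.
- rewrite (le_trans (Jg n))// delta0 add0r div1r -/(e n).
  by rewrite exprS ler_piMr ?(ltW (e0 n))// exprn_ile1// ltW.
- by apply: filterS => x; exact: cvg_series_cvg_0.
Qed.

End duality.

(** * Densities *)

Section density.
Context {d : measure_display} {T : measurableType d} {R : realType}.
Variable P : probability T R.
Variable f : T -> R.
Hypothesis mf : measurable_fun [set: T] f.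
Hypothesis f0 : forall x, 0 <= f x.
Hypothesis f1 : (\int[P]_x (f x)%:E = 1)%E.

(** The proofs are arguments so that the measure and probability structures can be attached to this
    set function. *)
Definition density of measurable_fun [set: T] f & (forall x, 0 <= f x) &
    (\int[P]_x (f x)%:E = 1)%E : set T -> \bar R :=
  fun A => (\int[P]_(x in A) (f x)%:E)%E.

Let Q := density mf f0 f1.

Let Q0 : Q set0 = 0%E. Proof. exact: integral_set0. Qed.

Let Q_ge0 A : (0 <= Q A)%E.
Proof. by apply: integral_ge0 => x _; rewrite lee_fin. Qed.

Let Q_sigma_additive : semi_sigma_additive Q.
Proof.
move=> A mA tA mUA; rewrite /Q /density; apply: cvg_toP.
  apply: ereal_nondecreasing_is_cvgn => m n mn.
  apply: lee_sum_nneg_natr => // k _ _.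
  by apply: integral_ge0 => x _; rewrite lee_fin.
rewrite ge0_integral_bigcup//=.
- by apply: measurable_funTS; exact/measurable_EFinP.
- by move=> x _; rewrite lee_fin.
Qed.

HB.instance Definition _ := isMeasure.Build _ _ _ (density mf f0 f1)
  Q0 Q_ge0 Q_sigma_additive.

HB.instance Definition _ :=
  @Measure_isProbability.Build _ _ R (density mf f0 f1) f1.

Definition density_probability : probability T R := density mf f0 f1.

Lemma density_integrable : P.-integrable [set: T] (EFin \o f).
Proof.
apply/integrableP; split; first exact/measurable_EFinP.
under eq_integral => x _ do rewrite /= ger0_norm//.
by rewrite f1 ltry.
Qed.

Lemma density_dominates : density_probability `<< P.
Proof.
apply/null_content_dominatesP => A mA PA0.
by apply: null_set_integral => //; exact/measurable_EFinP/measurable_funTS.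
Qed.

Lemma density_Radon_Nikodym : ae_eq P [set: T] (EFin \o f)
  (Radon_Nikodym (charge_of_finite_measure density_probability) P).
Proof.
apply: integral_ae_eq => //; first exact: density_integrable.
  by apply: measurable_int; apply: Radon_Nikodym_integrable; exact: density_dominates.
by move=> E _ mE; rewrite -Radon_Nikodym_integral//; exact: density_dominates.
Qed.

End density.

Section Radon_Nikodym.
Context {d : measure_display} {T : measurableType d} {R : realType}.
Variables (P Q : probability T R) (D : T -> R).
Hypothesis QP : Q `<< P.
Hypothesis mD : measurable_fun [set: T] D.
Hypothesis D0 : forall x, 0 <= D x.
Hypothesis DRN : ae_eq P [set: T] (EFin \o D)
  (Radon_Nikodym (charge_of_finite_measure Q) P).

Lemma integral_Radon_Nikodym g : bmeas g ->
  (\int[Q]_x (g x)%:E = \int[P]_x (g x * D x)%:E)%E.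
Proof.
move=> bg; rewrite -(Radon_Nikodym_change_of_variables QP)//; last first.
  exact: bmeas_integrable.
have [mg _] := bg; apply: ae_eq_integral => //.
- apply: emeasurable_funM; first exact/measurable_EFinP.
  by apply: measurable_int; exact: Radon_Nikodym_integrable.
- by apply/measurable_EFinP; exact: measurable_funM.
- by apply: filterS DRN => x /(_ I) /= <- _; rewrite EFinM.
Qed.

Lemma Radon_Nikodym_measure A : measurable A ->
  Q A = (\int[P]_(x in A) (D x)%:E)%E.
Proof.
move=> mA; rewrite -[LHS]/(charge_of_finite_measure Q A).
rewrite (@Radon_Nikodym_integral _ _ _ _ P)//.
apply: ae_eq_integral => //.
- apply: measurable_funTS.
  by apply: measurable_int; exact: Radon_Nikodym_integrable.
- by apply/measurable_EFinP; exact: measurable_funTS.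
- by apply: filterS DRN => x /(_ I) /= <- _.
Qed.

Lemma Radon_Nikodym_version_integrable : P.-integrable [set: T] (EFin \o D).
Proof.
apply/integrableP; split; first exact/measurable_EFinP.
under eq_integral => x _ do rewrite /= ger0_norm//.
by rewrite -Radon_Nikodym_measure// probability_setT ltry.
Qed.

End Radon_Nikodym.

(** * Semiconvex functions *)

Section semiconvex.
Context {R : realType}.
Variables (h : R -> R) (C : R).
Hypothesis h_cont : {within `[0, +oo[, continuous h}.
Hypothesis h_diff : forall x, 0 < x -> derivable h x 1.
Hypothesis h_diff2 : forall x, 0 < x -> derivable (derive1 h) x 1.
Hypothesis h''_ge : forall x, 0 < x -> C <= derive1n 2 h x.

Lemma derive1_continuous x : 0 < x -> {for x, continuous (derive1 h)}.
Proof.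
by move=> x0; apply/differentiable_continuous/derivable1_diffP/h_diff2.
Qed.

Lemma derive1_semimonotone x y : 0 < x -> x <= y ->
  C * (y - x) <= derive1 h y - derive1 h x.
Proof.
move=> x0; rewrite le_eqVlt => /predU1P[->|xy]; first by rewrite !subrr mulr0.
have d2 z : z \in `]x, y[%R -> is_derive z 1 (derive1 h) (derive1n 2 h z).
  rewrite in_itv/= => /andP[xz _].
  by have /derivableP := h_diff2 (lt_trans x0 xz); rewrite -derive1E.
have [|z] := MVT xy d2.
  apply/continuous_in_subspaceT => z /set_mem /=; rewrite in_itv/= => /andP[xz _].
  exact/derive1_continuous/(lt_le_trans x0).
rewrite in_itv/= => /andP[xz _] ->.
by rewrite ler_pM2r ?subr_gt0// h''_ge// (lt_trans x0).
Qed.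

(** The mean value theorem gives the slope at a point between [x] and [x + s], and
    [derive1_semimonotone] moves it to [x + s] at a cost of [|C| * |s|]. Evaluating at the endpoint
    [x + s] allows [x = 0], where [h] may have no finite derivative. *)
Lemma semiconvex_le x s : 0 <= x -> 0 < x + s ->
  h (x + s) - h x <= s * derive1 h (x + s) + `|C| * s ^+ 2.
Proof.
move=> x0 xs0.
have mvt a b : 0 <= a -> a < b ->
    exists2 c, a < c < b & h b - h a = derive1 h c * (b - a).
  move=> a0 ab; have d1 z : z \in `]a, b[%R -> is_derive z 1 h (derive1 h z).
    rewrite in_itv/= => /andP[az _].
    by rewrite derive1E; apply/derivableP/h_diff/(le_lt_trans a0).
  have [|c cab ->] := MVT ab d1; last by exists c.
  apply: continuous_subspaceW h_cont => z /=; rewrite !in_itv/= andbT.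
  by move=> /andP[az _]; exact: le_trans az.
have CN : - `|C| <= C by rewrite lerNl -normrN ler_norm.
have [s0|s0|<-] := ltrgtP 0 s.
- have xxs : x < x + s by rewrite ltrDl.
  have [c /andP[xc cxs] ->] := mvt _ _ x0 xxs.
  have := derive1_semimonotone (le_lt_trans x0 xc) (ltW cxs).
  have : - `|C| * (x + s - c) <= C * (x + s - c).
    by rewrite ler_wpM2r// subr_ge0 ltW.
  have : `|C| * (x + s - c) <= `|C| * s by rewrite ler_wpM2l//; lra.
  by rewrite [x + s - x]addrAC subrr add0r; nra.
- have xsx : x + s < x by rewrite gtrDl.
  have [c /andP[xsc cx]] := mvt _ _ (ltW xs0) xsx.
  have := derive1_semimonotone xs0 (ltW xsc).
  have : - `|C| * (c - (x + s)) <= C * (c - (x + s)).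
    by rewrite ler_wpM2r// subr_ge0 ltW.
  have : `|C| * (c - (x + s)) <= `|C| * - s by rewrite ler_wpM2l//; lra.
  by rewrite opprD addNKr; nra.
- by rewrite addr0 subrr mul0r expr0n/= mulr0 addr0.
Qed.

(** A real-valued stand-in for [ederive h] on the half-line, so that integrals of bounded real
    functions can be used. *)
Definition derive1_at0 (c x : R) : R := if 0 < x then derive1 h x else c.

Lemma measurable_derive1_at0 c : measurable_fun [set: R] (derive1_at0 c).
Proof.
apply: measurable_fun_if => //; first exact: measurable_fun_ltr.
rewrite setTI; apply: subspace_continuous_measurable_fun.
  rewrite [X in measurable X](_ : _ = `]0, +oo[%classic)//.
  by apply/seteqP; split => x /=; rewrite in_itv/= andbT.
apply: continuous_in_subspaceT => x /set_mem /= x0.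
exact: derive1_continuous.
Qed.

Lemma measurable_comp_ge0 d (T : measurableType d) (f : T -> R) :
  measurable_fun [set: T] f -> (forall x, 0 <= f x) ->
  measurable_fun [set: T] (fun x => h (f x)).
Proof.
move=> mf f0.
have mh : measurable_fun (`[0, +oo[%classic : set R) h.
  exact: subspace_continuous_measurable_fun.
apply: (measurable_comp _ _ mh mf) => //.
by move=> _ [x _ <-] /=; rewrite in_itv/= f0.
Qed.

Hypothesis h'0_cvg : cvg ((derive1 h x)%:E @[x --> 0^'+]).

Lemma derive1_lt_near0 c : (ederive h 0 < c%:E)%E ->
  \forall x \near 0^'+, derive1 h x < c.
Proof.
rewrite /ederive eqxx => c0.
have H : \forall y \near (lim ((derive1 h y)%:E @[y --> 0^'+])), (y < c%:E)%E.
  exact: open_ereal_lt'.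
have cv : (derive1 h y)%:E @[y --> 0^'+] --> lim ((derive1 h y)%:E @[y --> 0^'+]).
  exact: h'0_cvg.
exact: (cv _ H).
Qed.

End semiconvex.

(** * First-order optimality *)

Section perturbation.
Context {R : realType} {T : ptopologicalType}.
Variables (P : probability (borel T) R) (F : set (T -> R)).
Variables (h : R -> R) (C : R).
Hypothesis bF : forall f, F f -> bmeas (f : borel T -> R).
Hypothesis h_ge0 : forall x, 0 <= x -> 0 <= h x.
Hypothesis h_cont : {within `[0, +oo[, continuous h}.
Hypothesis h_diff : forall x, 0 < x -> derivable h x 1.
Hypothesis h'0_cvg : cvg ((derive1 h x)%:E @[x --> 0^'+]).
Hypothesis h_diff2 : forall x, 0 < x -> derivable (derive1 h) x 1.
Hypothesis h''_ge : forall x, 0 < x -> C <= derive1n 2 h x.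

Lemma Gh_RN_version (Q : probability (borel T) R) D :
  Q `<< P -> RN_version P Q D -> Gh h P Q = (\int[P]_x (h (D x))%:E)%E.
Proof.
move=> QP [mD D0 DRN]; rewrite /Gh asboolT//.
have mRN : measurable_fun [set: borel T]
    (Radon_Nikodym (charge_of_finite_measure Q) P).
  by apply: measurable_int; exact: Radon_Nikodym_integrable.
apply: ae_eq_integral => //.
- apply/measurable_EFinP; apply: measurable_comp_ge0 => //; last first.
    by move=> x; rewrite le_max lexx.
  by apply: measurable_maxr => //; exact: measurableT_comp.
- by apply/measurable_EFinP; exact: measurable_comp_ge0.
- apply: filterS DRN => x /(_ I) /= <- _ /=.
  by rewrite max_r.
Qed.

Variable Q : probability (borel T) R.
Hypothesis Q_opt : optimizer h P F Q.
Hypothesis Q_fin : (Gh h P Q < +oo)%E.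
Variable D : borel T -> R.
Hypothesis hD : RN_version P Q D.

Lemma optimizer_dominates : Q `<< P.
Proof.
by move: Q_fin; rewrite /Gh; case: ifPn => [/asboolP//|]; rewrite ltxx.
Qed.

Let mD : measurable_fun [set: borel T] D. Proof. by case: hD. Qed.
Let D0 x : 0 <= D x. Proof. by case: hD. Qed.
Let DRN : ae_eq P [set: borel T] (EFin \o D)
  (Radon_Nikodym (charge_of_finite_measure Q) P).
Proof. by case: hD. Qed.

Let iD : P.-integrable [set: borel T] (EFin \o D).
Proof. exact: Radon_Nikodym_version_integrable optimizer_dominates mD D0 DRN. Qed.

Let mhD : measurable_fun [set: borel T] (fun x => h (D x)).
Proof. exact: measurable_comp_ge0. Qed.

Let ihD : P.-integrable [set: borel T] (fun x => (h (D x))%:E).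
Proof.
apply/integrableP; split; first exact/measurable_EFinP.
under eq_integral => x _ do rewrite /= ger0_norm ?h_ge0//.
by rewrite -(Gh_RN_version optimizer_dominates hD).
Qed.

(** The function [D + k] is the density of another admissible probability, to which the optimality
    of [Q] applies. *)
Lemma optimizer_perturbation_le (k : borel T -> R) : bmeas k ->
  (forall x, 0 <= D x + k x) -> \int[P]_x k x = 0 ->
  (forall f, F f -> \int[P]_x (f x * k x) = 0) ->
  (\int[P]_x (h (D x))%:E <= \int[P]_x (h (D x + k x))%:E)%E.
Proof.
move=> bk Dk0 k0 Fk0; have [mk _] := bk.
have mDk : measurable_fun [set: borel T] (fun x => D x + k x).
  exact: measurable_funD.
have ik := bmeas_integrable P bk.
have Dk1 : (\int[P]_x (D x + k x)%:E = 1)%E.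
  under eq_integral do rewrite EFinD.
  rewrite integralD//= -(EFin_Rintegral P bk) k0 adde0.
  rewrite -(Radon_Nikodym_measure optimizer_dominates mD DRN)//.
  exact: probability_setT.
pose Q' := density_probability mDk Dk0 Dk1.
have Q'P : Q' `<< P := density_dominates mDk Dk0 Dk1.
have hQ' : RN_version P Q' (fun x => D x + k x).
  by split => //; exact: density_Radon_Nikodym.
rewrite -(Gh_RN_version optimizer_dominates hD) -(Gh_RN_version Q'P hQ').
have [Qadm Qmin] := Q_opt; apply: Qmin => f Ff.
have bf := bF Ff; have bfk := bmeasM bf bk.
case: hQ' => [_ _ Q'RN].
have ifD : P.-integrable [set: borel T] (fun x => (f x * D x)%:E).
  have [mf [M fM]] := bf.
  have := @integrableMr _ _ _ P _ measurableT f _ mf _ iD.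
  apply; exists M; split; first exact: num_real.
  by move=> r Mr x _; apply: le_trans (fM x) (ltW Mr).
have ifk := bmeas_integrable P bfk.
rewrite (integral_Radon_Nikodym Q'P mDk Q'RN bf).
under eq_integral do rewrite mulrDr EFinD.
rewrite integralD//= -(integral_Radon_Nikodym optimizer_dominates mD DRN bf) Qadm//.
by rewrite -(EFin_Rintegral P bfk) Fk0// adde0.
Qed.

(* [c] is a finite substitute for the possibly infinite right derivative of [h]
   at [0]. *)
Variable c : R.
Hypothesis h'0_le : (ederive h 0 <= c%:E)%E.
Let phi x := derive1_at0 h c (D x).

Let mphi : measurable_fun [set: borel T] phi.
Proof. by apply: measurableT_comp => //; exact: measurable_derive1_at0. Qed.

Variables p q : borel T -> R.
Hypothesis p01 : forall x, 0 <= p x <= 1.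
Hypothesis q01 : forall x, 0 <= q x <= 1.
Hypothesis pphi : forall x, p x * phi x ^+ 2 <= 1.
Hypothesis qphi : forall x, q x * phi x ^+ 2 <= 1.
Hypothesis ph' : forall x, p x * `|derive1 h (D x + 1)| <= 1.
Hypothesis qh' : forall x, 0 < D x -> q x * `|derive1 h (D x / 2)| <= 1.
Hypothesis q_le : forall x, q x <= D x / 2.
Hypothesis qD : forall x, q x * D x <= 1.

(** Perturb [D] by [e n * k] with [e n] tending to 0: the difference quotients of the objective are
    nonnegative, and they are dominated by functions converging to [phi * k]. *)
Lemma optimizer_derivative_ge0 (k : borel T -> R) :
  measurable_fun [set: borel T] k -> (forall x, - q x <= k x <= p x) ->
  \int[P]_x k x = 0 -> (forall f, F f -> \int[P]_x (f x * k x) = 0) ->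
  0 <= \int[P]_x (phi x * k x).
Proof.
move=> mk kpq k0 Fk0.
have p0 x : 0 <= p x by have /andP[] := p01 x.
have q0 x : 0 <= q x by have /andP[] := q01 x.
have k_p x : k x <= p x by have /andP[] := kpq x.
have k_q x : - q x <= k x by have /andP[] := kpq x.
have k1 x : `|k x| <= 1.
  have := k_p x; have := k_q x; have /andP[_ p1] := p01 x.
  by have /andP[_ q1] := q01 x; rewrite ler_norml => *; apply/andP; split; lra.
have k21 x : k x ^+ 2 <= 1 by rewrite -(real_normK (num_real _)) exprn_ile1.
have bk : bmeas k by split => //; exists 1.
have C0 := normr_ge0 C.
pose e n : R := n.+1%:R^-1.
have e0 n : 0 < e n by rewrite invr_gt0.
have e1 n : e n <= 1 by rewrite invf_le1// ler1n.
have e_cvg : e n @[n --> \oo] --> 0 by exact: cvg_harmonic.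
(* Since [k >= - q >= - D / 2], the perturbed density is nonnegative, and positive wherever [D]
   is. *)
have Dek n x : D x / 2 <= D x + e n * k x.
  have : e n * q x <= q x by rewrite ler_piMl.
  have : e n * - q x <= e n * k x by rewrite ler_pM2l.
  by have := q_le x; lra.
have Dek0 n x : 0 <= D x + e n * k x.
  by apply: le_trans (Dek n x); rewrite divr_ge0.
(* By semiconvexity [u n] bounds the difference quotient of [h] between [D] and
   [D + e n * k]; the weights [p] and [q] make it bounded above. *)
pose u n x := k x * derive1_at0 h 0 (D x + e n * k x) + `|C| * (e n * k x ^+ 2).
(* The maximum with the expected limit adds a lower bound, so dominated convergence applies although
   [u n] is only bounded above. *)
pose Z n x := Num.max (u n x) (phi x * k x).
have measu n : measurable_fun [set: borel T] (u n).
  apply: measurable_funD; last first.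
    by do 2 apply: measurable_funM => //; exact: measurable_funX.
  apply: measurable_funM => //.
  apply: (measurableT_comp (measurable_derive1_at0 h_diff2 0)).
  by apply: measurable_funD => //; exact: measurable_funM.
have phik x : `|phi x * k x| <= 4.
  rewrite normrM.
  have : `|phi x| <= 1 + phi x ^+ 2.
    rewrite -(real_normK (num_real (phi x))).
    by have := sqr_ge0 (`|phi x| - 1); have := normr_ge0 (phi x); nra.
  have : `|k x| <= p x + q x.
    have := k_p x; have := k_q x; have := p0 x; have := q0 x.
    by rewrite ler_norml => *; apply/andP; split; lra.
  move=> h1 h2; rewrite (le_trans (ler_pM _ _ h2 h1))//.
  have /andP[_ p1] := p01 x; have /andP[_ q1] := q01 x.
  by have := pphi x; have := qphi x; nra.
(* For [k x >= 0] the slope is compared with the one at [D x + 1] and absorbed by [p]; for [k x < 0]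
   with the one at [D x / 2] and absorbed by [q]. *)
have u_le n x : u n x <= 1 + 2 * `|C|.
  have He : `|C| * (e n * k x ^+ 2) <= `|C|.
    by rewrite ler_piMr// mulr_ile1// ?sqr_ge0// ltW.
  suff : k x * derive1_at0 h 0 (D x + e n * k x) <= 1 + `|C| by rewrite /u; lra.
  have CN : - `|C| <= C by rewrite lerNl -normrN ler_norm.
  rewrite /derive1_at0; case: ifPn => [y0|_]; last by rewrite mulr0 addr_ge0.
  set y := D x + e n * k x in y0 *.
  have ek : e n * `|k x| <= `|k x| by rewrite ler_piMl.
  have [kx0|kx0] := leP 0 (k x).
    have yD1 : y <= D x + 1.
      rewrite /y lerD2l (le_trans _ (k1 x))// (le_trans _ ek)//.
      by rewrite ler_pM2l// ler_norm.
    have Dy : D x <= y by rewrite /y lerDl mulr_ge0// ltW.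
    have := derive1_semimonotone h_diff2 h''_ge y0 yD1.
    have : - `|C| * (D x + 1 - y) <= C * (D x + 1 - y).
      by rewrite ler_wpM2r// subr_ge0.
    have : `|C| * (D x + 1 - y) <= `|C| by rewrite ler_piMr//; lra.
    have := ler_norm (derive1 h (D x + 1)) => h1 h2 h3 h4.
    have h5 : derive1 h y <= `|derive1 h (D x + 1)| + `|C| by lra.
    have := ler_wpM2l kx0 h5.
    have : k x * (`|derive1 h (D x + 1)| + `|C|) <=
           p x * (`|derive1 h (D x + 1)| + `|C|).
      by rewrite ler_wpM2r ?addr_ge0// k_p.
    have : p x * `|C| <= `|C| by rewrite ler_piMl//; have /andP[] := p01 x.
    by have := ph' x; lra.
  have Dx0 : 0 < D x.
    by have := q_le x; have := k_q x; lra.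
  have D2 : 0 < D x / 2 by rewrite divr_gt0.
  have yD : y <= D x by rewrite /y gerDl pmulr_rle0// ltW.
  have := derive1_semimonotone h_diff2 h''_ge D2 (Dek n x); rewrite -/y.
  have Dy := Dek n x; rewrite -/y in Dy.
  have : - `|C| * (y - D x / 2) <= C * (y - D x / 2).
    by rewrite ler_wpM2r// subr_ge0.
  have : `|C| * (y - D x / 2) <= `|C| * D x by rewrite ler_wpM2l//; lra.
  have := ler_norm (- derive1 h (D x / 2)); rewrite normrN => h1 h2 h3 h4.
  have h5 : - derive1 h y <= `|derive1 h (D x / 2)| + `|C| * D x by lra.
  have nk0 : 0 <= - k x by lra.
  have := ler_wpM2l nk0 h5.
  have : - k x * (`|derive1 h (D x / 2)| + `|C| * D x) <=
         q x * (`|derive1 h (D x / 2)| + `|C| * D x).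
    by rewrite ler_wpM2r ?addr_ge0// ?mulr_ge0//; have := k_q x; lra.
  have : `|C| * (q x * D x) <= `|C| by rewrite ler_piMr.
  by have := qh' Dx0; lra.
(* Only an upper estimate can be expected: where [D x = 0] one has [k x >= 0], and the slopes near 0
   are merely eventually below any number above [c]. *)
have u_cvg x eta : 0 < eta -> \forall n \near \oo, u n x < phi x * k x + eta.
  move=> eta0.
  have ek_cvg : e n * k x @[n --> \oo] --> 0.
    by rewrite -[X in _ --> X](mul0r (k x)); apply: cvgMr_tmp.
  have Cek_cvg : `|C| * (e n * k x ^+ 2) @[n --> \oo] --> 0.
    rewrite [X in _ --> X](_ : 0 = `|C| * (0 * k x ^+ 2)); last by rewrite mul0r mulr0.
    by apply: cvgMl_tmp; apply: cvgMr_tmp.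
  have := D0 x; rewrite le_eqVlt => /predU1P[Dx0|Dx0].
    have kx0 : 0 <= k x.
      by have := q_le x; have := k_q x; have := q0 x; rewrite -Dx0; lra.
    have [kx|kx] := leP (k x) 0.
      have {kx kx0} kx : k x = 0 by apply/le_anti/andP.
      by apply: nearW => n; rewrite /u kx !mul0r expr0n/= !mulr0 !add0r.
    have phic : phi x = c by rewrite /phi /derive1_at0 -Dx0 ltxx.
    have h'c : (ederive h 0 < (c + eta / (2 * k x))%:E)%E.
      rewrite (le_lt_trans h'0_le)// lte_fin ltrDl divr_gt0// mulr_gt0//.
    have near1 : \forall n \near \oo, 0 < e n * k x ->
        derive1 h (e n * k x) < c + eta / (2 * k x).
      exact: ek_cvg _ (derive1_lt_near0 h'0_cvg h'c).
    have eta2 : 0 < eta / 2 by rewrite divr_gt0.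
    have near2 : \forall n \near \oo, `|C| * (e n * k x ^+ 2) < eta / 2.
      exact: cvgr_lt Cek_cvg _ eta2.
    apply: filterS2 near1 near2 => n /= near1 near2.
    have ek0 : 0 < e n * k x by rewrite mulr_gt0.
    rewrite /u /derive1_at0 -Dx0 add0r ek0 phic.
    have := near1 ek0; rewrite -(ltr_pM2l kx) mulrDr.
    have -> : k x * (eta / (2 * k x)) = eta / 2 by field; rewrite gt_eqF.
    by lra.
  have Dek_cvg : D x + e n * k x @[n --> \oo] --> D x.
    by rewrite -[X in _ --> X]addr0; apply: cvgD => //; exact: cvg_cst.
  have h'_cvg := cvg_comp _ _ Dek_cvg (derive1_continuous h_diff2 Dx0).
  have : k x * derive1 h (D x + e n * k x) + `|C| * (e n * k x ^+ 2)
      @[n --> \oo] --> phi x * k x.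
    rewrite -[X in _ --> X]addr0; apply: cvgD => //.
    rewrite /phi /derive1_at0 Dx0 mulrC.
    by apply: cvgMl_tmp.
  move=> /cvgr_lt/(_ (phi x * k x + eta)); rewrite ltrDl => /(_ eta0).
  apply: filterS => n; rewrite /u /derive1_at0.
  by rewrite (lt_le_trans _ (Dek n x))// divr_gt0.
have Z_cvg x : Z n x @[n --> \oo] --> phi x * k x.
  apply/cvgrPdist_lt => eta eta0; apply: filterS (u_cvg x _ eta0) => n un.
  rewrite /Z distrC ger0_norm ?subr_ge0 ?le_max ?lexx ?orbT//.
  by rewrite ltrBlDl gt_max un/= ltrDl.
have Z_bound n x : `|Z n x| <= 5 + 2 * `|C|.
  have := phik x; rewrite !ler_norml => /andP[h1 h2].
  rewrite /Z le_max ge_max; have := u_le n x => h3.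
  by apply/andP; split; [apply/orP; right; lra|apply/andP; split; lra].
have bZ n : bmeas (Z n).
  split; last by exists (5 + 2 * `|C|).
  by apply: measurable_maxr => //; exact: measurable_funM.
(* By semiconvexity [h (D + e n * k) <= h (D) + e n * Z n] pointwise. Optimality then allows the
   finite integral of [h (D)] to be cancelled and [e n] divided out. *)
have Z_ge0 n : 0 <= \int[P]_x Z n x.
  have bek : bmeas (fun x => e n * k x) by exact: bmeasZ.
  have := optimizer_perturbation_le bek (Dek0 n).
  rewrite bmeas_RintegralZ// k0 mulr0 => /(_ erefl).
  have Fek f : F f -> \int[P]_x (f x * (e n * k x)) = 0.
    move=> Ff; rewrite -[RHS](mulr0 (e n)) -(Fk0 f Ff) -bmeas_RintegralZ.
      by apply: eq_Rintegral => x _; ring.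
    by apply: bmeasM => //; exact: bF.
  move=> /(_ Fek) le1.
  have le2 : (\int[P]_x (h (D x + e n * k x))%:E <=
      \int[P]_x ((h (D x))%:E + (e n * Z n x)%:E))%E.
    apply: ge0_le_integral => //.
    - by move=> x _; rewrite lee_fin h_ge0.
    - apply/measurable_EFinP; apply: measurable_comp_ge0 => //.
      by apply: measurable_funD => //; exact: measurable_funM.
    - by apply/measurable_EFinP/measurable_funD => //; case: (bmeasZ (e n) (bZ n)).
    - move=> x _; rewrite -EFinD lee_fin -lerBlDl.
      apply: le_trans (_ : e n * u n x <= _); last first.
        by rewrite ler_pM2l// le_max lexx.
      rewrite /u /derive1_at0; case: ifPn => [y0|].
        have := semiconvex_le h_cont h_diff h_diff2 h''_ge (D0 x) y0.
        by move=> /le_trans; apply; rewrite le_eqVlt; apply/orP; left; apply/eqP; ring.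
      rewrite -leNgt => y0.
      have Dx0 : D x = 0.
        by apply/le_anti; rewrite D0 andbT; have := Dek n x; lra.
      have ek0 : e n * k x = 0 by have := Dek0 n x; move: y0; rewrite Dx0; lra.
      have -> : k x = 0.
        by apply/eqP; move/eqP: ek0; rewrite mulf_eq0 gt_eqF.
      by rewrite mulr0 addr0 subrr mul0r expr0n/= !mulr0 addr0 mulr0.
  have := le_trans le1 le2; rewrite integralD//; last first.
    by apply: bmeas_integrable; exact: bmeasZ.
  rewrite -(EFin_Rintegral P (bmeasZ (e n) (bZ n))).
  rewrite -(fineK (integrable_fin_num measurableT ihD)) -EFinD lee_fin.
  by rewrite lerDl bmeas_RintegralZ// pmulr_rge0.
have := @bmeas_dominated _ _ _ P Z (fun x => phi x * k x) (5 + 2 * `|C|).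
case/(_ _ _ _ _)/Wrap => //.
- by move=> n; case: (bZ n).
- exact: measurable_funM.
- exact: aeW.
move=> cv; rewrite -(cvg_lim _ cv)//; apply: limr_ge; last exact: nearW.
by apply/cvg_ex; eexists; exact: cv.
Qed.

End perturbation.

(** * Finitely supported measures and weights *)

Lemma bmeas_le_Rintegral_on d (T : measurableType d) (R : realType)
    (mu : {finite_measure set T -> \bar R}) (S : set T) (f g : T -> R) :
  measurable S -> mu (~` S) = 0%E -> bmeas f -> bmeas g ->
  (forall x, S x -> f x <= g x) -> \int[mu]_x f x <= \int[mu]_x g x.
Proof.
move=> mS S0 bf bg fg.
have bS : bmeas (\1_S : T -> R).
  split; first exact: measurable_indic.
  by exists 1 => x; rewrite indicE normr_nat lern1 leq_b1.
have E u : bmeas u -> \int[mu]_x u x = \int[mu]_x (u x * \1_S x).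
  move=> bu; congr fine; apply: ae_eq_integral => //.
  - by apply/measurable_EFinP; case: bu.
  - by apply/measurable_EFinP; case: (bmeasM bu bS).
  - exists (~` S); split => //; first exact: measurableC.
    apply: subsetC => x Sx _; rewrite indicE mem_set// mulr1//.
rewrite (E f bf) (E g bg); apply: bmeas_le_Rintegral; try exact: bmeasM.
move=> x; rewrite indicE; have [/set_mem Sx|_] := boolP (x \in S).
  by rewrite !mulr1 fg.
by rewrite !mulr0.
Qed.

Lemma continuous_borel_measurable (R : realType) (T : ptopologicalType)
  (f : T -> R) : continuous f -> measurable_fun [set: borel T] (f : borel T -> R).
Proof.
move=> cf; apply: (measurability _ (RGenOInfty.measurableE R)) => //.
move=> _ [_ [x ->] <-]; rewrite setTI; apply: sub_sigma_algebra.
by apply: open_comp => //; exact: interval_open.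
Qed.

Section support.
Context {R : realType} {T : ptopologicalType}.
Hypothesis hT : polish_space R T.
Variable a : {measure set (borel T) -> \bar R}.

Lemma measurable_msupport : measurable (msupport a : set (borel T)).
Proof.
rewrite -[X in measurable X]setCK; apply: measurableC.
apply: sub_sigma_algebra; rewrite /= openE => x /existsNP[U].
move=> /not_implyP[oU /not_implyP[Ux U0]].
rewrite /interior; apply: filterS (open_nbhs_nbhs (conj oU Ux)) => y Uy.
by move=> /(_ U oU Uy).
Qed.

(** Every point off the support lies in a null ball centred in the countable dense set with radius
    [n.+1%:R^-1]. There are countably many such balls; those of positive measure are replaced by the
    empty set. *)
Lemma msupportC_null : a (~` msupport a) = 0%E.
Proof.
have [[S cS dS] [d [[d0 dE dC dD] dnbhs _]]] := hT.
pose B x e : set (borel T) := [set y | d x y < e].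
have oB x e : @open T (B x e).
  rewrite openE => y /= Bxy; apply/dnbhs; exists (e - d x y).
    by rewrite subr_gt0.
  by move=> z /= yz; rewrite /B/= (le_lt_trans (dD _ y _))// -ltrBrDl.
have mB x e : measurable (B x e) by exact: sub_sigma_algebra.
have [S0|[f]] := pfcard_geP cS.
  have [|x [_]] := dS setT _ openT; first by exists point.
  by rewrite S0.
have nB s n : a.-negligible
    (if a (B s n.+1%:R^-1) == 0%E then B s n.+1%:R^-1 else set0).
  by case: ifPn => [/eqP aB|_]; [exact/negligibleP|exact: negligible_set0].
apply/negligibleP; first by apply: measurableC; exact: measurable_msupport.
apply: negligibleS (negligible_bigcup (fun i => negligible_bigcup (nB (f i)))).
move=> x /existsNP[U] /not_implyP[oU /not_implyP[Ux U0]].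
have aU : a U = 0%E.
  by apply/eqP; rewrite eq_le measure_ge0 andbT leNgt; exact/negP.
have /dnbhs[e e0 BU] : nbhs x U by exact: open_nbhs_nbhs.
have e2 : 0 < e / 2 by rewrite divr_gt0.
have [n ne] : exists n, n.+1%:R^-1 < e / 2.
  have /cvgr_lt/(_ _ e2)[n _ /(_ n (leqnn n))] := @cvg_harmonic R.
  by exists n.
have n0 : 0 < n.+1%:R^-1 :> R by rewrite invr_gt0.
have [|s [/= xs Ss]] := dS (B x n.+1%:R^-1) _ (oB _ _).
  by exists x; rewrite /B/= (dE x x).2.
have [i _ fi] := @surj _ _ _ _ f s Ss.
exists i => //; exists n => //; rewrite fi.
have sU : B s n.+1%:R^-1 `<=` U.
  move=> y /= sy; apply: BU => /=; rewrite (le_lt_trans (dD _ s _))//.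
  by rewrite (splitr e) ltrD// (lt_trans _ ne).
rewrite ifT; first by rewrite /B/= dC.
rewrite eq_le measure_ge0 andbT -aU le_measure// ?inE//.
exact: sub_sigma_algebra.
Qed.

End support.

Section weights.
Context {d : measure_display} {T : measurableType d} {R : realType}.

Lemma mulr_expRN_le1 (x y : R) : x <= 1 + y -> x * expR (- y) <= 1.
Proof.
move=> xy; rewrite expRN ler_pdivrMr ?expR_gt0// mul1r (le_trans xy)//.
exact: expR_ge1Dx.
Qed.

Lemma expRN_le1 (y : R) : 0 <= y -> expR (- y) <= 1.
Proof. by move=> y0; rewrite -[leLHS]mul1r mulr_expRN_le1// lerDl. Qed.

Variables (u v phi D : T -> R).
Hypothesis measu : measurable_fun [set: T] u.
Hypothesis measv : measurable_fun [set: T] v.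
Hypothesis mphi : measurable_fun [set: T] phi.
Hypothesis mD : measurable_fun [set: T] D.
Hypothesis D0 : forall x, 0 <= D x.

(** Exponential factors absorb [u], [v] and [phi] by [mulr_expRN_le1]. In [q], the factor [D x / 2]
    forces vanishing where [D] does, and [expR (- (D x ^+ 2))] keeps [q x] and [q x * D x] at most
    1. *)
Lemma exists_weights : exists p q : T -> R,
  [/\ measurable_fun [set: T] p /\ measurable_fun [set: T] q,
      forall x, 0 < p x <= 1 /\ 0 <= q x <= 1,
      forall x, p x * phi x ^+ 2 <= 1 /\ q x * phi x ^+ 2 <= 1,
      forall x, p x * `|u x| <= 1 /\ q x * `|v x| <= 1 &
      forall x, [/\ 0 < D x -> 0 < q x, q x <= D x / 2 & q x * D x <= 1]].
Proof.
have mw (w : T -> R) : measurable_fun [set: T] w ->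
    measurable_fun [set: T] (fun x => expR (- (`|w x| + phi x ^+ 2))).
  move=> mw; apply: measurableT_comp => //; apply: measurable_funN.
  apply: measurable_funD; last exact: measurable_funX.
  exact: measurableT_comp.
pose r x := D x / 2 * expR (- (D x ^+ 2)).
pose w x := expR (- (`|v x| + phi x ^+ 2)).
exists (fun x => expR (- (`|u x| + phi x ^+ 2))), (fun x => r x * w x).
have r0 x : 0 <= r x by rewrite mulr_ge0 ?divr_ge0// expR_ge0.
have w0 x : 0 <= w x by exact: expR_ge0.
have w1 x : w x <= 1 by rewrite expRN_le1// addr_ge0// sqr_ge0.
have r1 x : r x <= 1.
  by rewrite mulr_expRN_le1//; have := sqr_ge0 (D x - 1); have := sqr_ge0 (D x); lra.
have rD x : r x <= D x / 2.
  by rewrite ler_piMr ?divr_ge0// expRN_le1// sqr_ge0.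
split.
- split; first exact: mw.
  apply: measurable_funM; last exact: mw.
  apply: measurable_funM; first exact: measurable_funM.
  apply: measurableT_comp => //; apply: measurable_funN.
  exact: measurable_funX.
- move=> x; rewrite expR_gt0 expRN_le1 ?addr_ge0 ?sqr_ge0//.
  by rewrite mulr_ge0//= mulr_ile1.
- move=> x; split.
    by rewrite mulrC mulr_expRN_le1//; have := normr_ge0 (u x); lra.
  rewrite -mulrA; apply: mulr_ile1 => //; first by rewrite mulr_ge0 ?sqr_ge0.
  by rewrite mulrC mulr_expRN_le1//; have := normr_ge0 (v x); lra.
- move=> x; split.
    by rewrite mulrC mulr_expRN_le1//; have := sqr_ge0 (phi x); lra.
  rewrite -mulrA; apply: mulr_ile1 => //; first by rewrite mulr_ge0.
  by rewrite mulrC mulr_expRN_le1//; have := sqr_ge0 (phi x); lra.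
- move=> x; split.
  + by move=> Dx; rewrite !mulr_gt0// expR_gt0.
  + by rewrite (le_trans _ (rD x))// ler_piMr.
  + rewrite mulrAC; apply: mulr_ile1 => //; first by rewrite mulr_ge0.
    rewrite /r mulrAC mulr_expRN_le1//.
    by have := sqr_ge0 (D x); lra.
Qed.

End weights.

(** * Approximation along competitors *)

Lemma near_finite_set (T : choiceType) (S : set T) (Q : nat -> T -> Prop) :
  finite_set S -> (forall x, S x -> \forall n \near \oo, Q n x) ->
  \forall n \near \oo, forall x, S x -> Q n x.
Proof.
move=> /finite_seqP[s ->]; elim: s => [|y s IHs] sQ.
  by apply: nearW => n x; rewrite /= in_nil.
have Qy : \forall n \near \oo, Q n y by apply: sQ; rewrite /= mem_head.
have Qs : \forall n \near \oo, forall x, [set` s] x -> Q n x.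
  by apply: IHs => x /= xs; apply: sQ; rewrite /= inE xs orbT.
apply: filterS2 Qy Qs => n Qy Qs x /=; rewrite inE => /predU1P[->//|].
exact: Qs.
Qed.

Lemma whuber_cvg0_lt (R : realType) (p q : R) (s : nat -> R) :
  0 < p -> 0 <= q -> whuber p q (s n) @[n --> \oo] --> 0 ->
  forall e, 0 < e -> \forall n \near \oo, s n < e.
Proof.
move=> p0 q0 s0 e e0; pose e' := Num.min e 1.
have e'0 : 0 < e' by rewrite lt_min e0 ltr01.
have e'1 : e' <= 1 by rewrite ge_min lexx orbT.
have pe : 0 < p * (e' ^+ 2 / 2) by rewrite mulr_gt0// divr_gt0// exprn_gt0.
apply: filterS (cvgr_lt _ s0 _ pe) => n ws.
have : p * huber (s n) < p * (e' ^+ 2 / 2).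
  by apply: le_lt_trans ws; rewrite lerDl mulr_ge0// huber_ge0.
have e'01 : 0 < e' <= 1 by rewrite e'0.
rewrite ltr_pM2l// => /(huber_lt e'01)/lt_le_trans; apply.
by rewrite ge_min lexx.
Qed.

Lemma whuberN (R : realType) (p q s : R) : whuber q p (- s) = whuber p q s.
Proof. by rewrite /whuber opprK addrC. Qed.

Section approximation.
Context {R : realType} {T : ptopologicalType}.
Variables (P : probability (borel T) R) (F : set (T -> R)).
Variables (h : R -> R) (C : R).
Hypothesis bF : forall f, F f -> bmeas (f : borel T -> R).
Hypothesis h_ge0 : forall x, 0 <= x -> 0 <= h x.
Hypothesis h_cont : {within `[0, +oo[, continuous h}.
Hypothesis h_diff : forall x, 0 < x -> derivable h x 1.
Hypothesis h'0_cvg : cvg ((derive1 h x)%:E @[x --> 0^'+]).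
Hypothesis h_diff2 : forall x, 0 < x -> derivable (derive1 h) x 1.
Hypothesis h''_ge : forall x, 0 < x -> C <= derive1n 2 h x.
Variable Q : probability (borel T) R.
Hypothesis Q_opt : optimizer h P F Q.
Hypothesis Q_fin : (Gh h P Q < +oo)%E.
Variable D : borel T -> R.
Hypothesis hD : RN_version P Q D.

(* This space replaces the linear span of [F] and the constants. *)
Definition competitor_invariant : set (borel T -> R) :=
  [set g | bmeas g /\
    forall a a' : {finite_measure set (borel T) -> \bar R},
      competitors F a a' -> \int[a]_x g x = \int[a']_x g x].

(** First-order optimality supplies the dual hypothesis of [ae_approximation], as the invariant
    space contains [F] and the constants. Since [p] is positive everywhere but [q] only where [D]
    is, the lower approximation is confined to [0 < D x]. *)
Lemma optimizer_ae_approximation c : (ederive h 0 <= c%:E)%E ->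
  exists2 g_ : nat -> borel T -> R, (forall n, competitor_invariant (g_ n)) &
  {ae P, forall x, forall e, 0 < e ->
    (\forall n \near \oo, g_ n x < derive1_at0 h c (D x) + e) /\
    (0 < D x -> \forall n \near \oo, derive1_at0 h c (D x) < g_ n x + e)}.
Proof.
move=> h'0_le; have [mD D0 _] := hD.
have md := measurable_derive1_at0 h_diff2.
have mphi : measurable_fun [set: borel T] (fun x => derive1_at0 h c (D x)).
  exact: (measurableT_comp (md c)).
have m1 : measurable_fun [set: borel T] (fun x => derive1_at0 h 0 (D x + 1)).
  by apply: (measurableT_comp (md 0)); exact: measurable_funD.
have m2 : measurable_fun [set: borel T] (fun x => derive1_at0 h 0 (D x / 2)).
  by apply: (measurableT_comp (md 0)); exact: measurable_funM.
have [p [q [[mp mq] pq01 pqphi pqh' qD]]] := exists_weights m1 m2 mphi mD D0.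
have p0 x : 0 < p x by have [/andP[]] := pq01 x.
have p01 x : 0 <= p x <= 1 by rewrite ltW//=; have [/andP[]] := pq01 x.
have q01 x : 0 <= q x <= 1 by have [] := pq01 x.
have q0 x : 0 <= q x by have /andP[] := q01 x.
have pphi x : p x * derive1_at0 h c (D x) ^+ 2 <= 1 by have [] := pqphi x.
have qphi x : q x * derive1_at0 h c (D x) ^+ 2 <= 1 by have [] := pqphi x.
have bV g : competitor_invariant g -> bmeas g by case.
have V1 : competitor_invariant (fun=> 1).
  split => [|a a' [aa' _ _ _]]; first exact: bmeas_cst.
  by rewrite !Rintegral_cst//; congr (_ * fine _); exact: aa'.
have FV f : F f -> competitor_invariant f.
  move=> Ff; split => [|a a' [_ _ _ /(_ f Ff)]]; first exact: bF.
  rewrite -!EFin_Rintegral; [|exact: bF..].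
  by rewrite -EFinB => -[] /subr0_eq.
have VD r s f g : competitor_invariant f -> competitor_invariant g ->
    competitor_invariant (fun x => r * f x + s * g x).
  move=> [bf fa] [bg ga]; split => [|a a' aa'].
    by apply: bmeasD; exact: bmeasZ.
  rewrite !bmeas_RintegralD; [|exact: bmeasZ..].
  by rewrite !bmeas_RintegralZ// (fa _ _ aa') (ga _ _ aa').
have V0 : competitor_invariant (fun=> 0).
  by have := VD 0 0 _ _ V1 V1; congr competitor_invariant; apply/funext => x;
    rewrite mul0r addr0.
have [|g_ Vg Wg] := ae_approximation bV V0 VD mphi mp mq p01 q01 pphi qphi (mu := P).
  move=> k mk kpq Vk.
  apply: (optimizer_derivative_ge0 bF h_ge0 h_cont h_diff h'0_cvg h_diff2 h''_ge
    Q_opt Q_fin hD h'0_le p01 q01 pphi qphi) => //.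
  - move=> x; have [+ _] := pqh' x.
    by rewrite /derive1_at0 ltr_wpDl.
  - move=> x Dx; have [_ +] := pqh' x.
    by rewrite /derive1_at0 divr_gt0.
  - by move=> x; have [] := qD x.
  - by move=> x; have [] := qD x.
  - by rewrite -(Vk _ V1); apply: eq_Rintegral => x _; rewrite mul1r.
  - by move=> f Ff; exact/Vk/FV.
exists g_ => //; apply: filterS Wg => x Wx e e0; split=> [|Dx].
  have := whuber_cvg0_lt (p0 x) (q0 x) Wx e0.
  by apply: filterS => n; rewrite ltrBlDl.
have qx : 0 < q x by have [/(_ Dx)] := qD x.
have Wx' : whuber (q x) (p x) (- (g_ n x - derive1_at0 h c (D x)))
    @[n --> \oo] --> 0.
  by under eq_fun do rewrite whuberN.
have := whuber_cvg0_lt qx (ltW (p0 x)) Wx' e0.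
by apply: filterS => n; rewrite opprB ltrBlDl.
Qed.

End approximation.

Section competitors.
Context {R : realType} {T : ptopologicalType}.
Hypothesis hT : polish_space R T.
Variable F : set (T -> R).
Variables a a' : {finite_measure set (borel T) -> \bar R}.
Hypothesis aa' : competitors F a a'.

(** Finiteness of the supports gives one index [n] for all their points. Both measures give [g_ n]
    the same integral, which then separates the two sides up to [e]. *)
Lemma competitors_le (g_ : nat -> borel T -> R) (f f' : borel T -> R) :
  (forall n, competitor_invariant F (g_ n)) -> bmeas f -> bmeas f' ->
  (forall x, msupport a x -> forall e, 0 < e ->
    \forall n \near \oo, f x < g_ n x + e) ->
  (forall x, msupport a' x -> forall e, 0 < e ->
    \forall n \near \oo, g_ n x < f' x + e) ->
  \int[a]_x f x <= \int[a']_x f' x.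
Proof.
move=> Vg bf bf' fg gf.
have [aT fa fa' _] := aa'.
set m := \int[a]_x (1 : R).
have m0 : 0 <= m by exact: Rintegral_ge0.
have m' : \int[a']_x (1 : R) = m by rewrite /m !Rintegral_cst//; congr (_ * fine _); exact: esym aT.
apply/ler_addgt0Pr => e e0.
(* The error [e'] is incurred once on each side against the common mass [m]; the added 1 covers
   [m = 0]. *)
pose e' := e / (2 * (m + 1)).
have m1 : 0 < 2 * (m + 1) by rewrite mulr_gt0// ltr_wpDl.
have e'0 : 0 < e' by rewrite divr_gt0.
have e'e : 2 * m * e' <= e.
  by rewrite /e' mulrCA ler_piMr ?(ltW e0)// ler_pdivrMr//; lra.
have N1 := near_finite_set fa (fun x ax => fg x ax e' e'0).
have N2 := near_finite_set fa' (fun x ax => gf x ax e' e'0).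
have [n [f_le g_le]] : exists n, (forall x, msupport a x -> f x < g_ n x + e') /\
    (forall x, msupport a' x -> g_ n x < f' x + e').
  have [n _ /(_ n (leqnn n))] := filterI N1 N2.
  by exists n.
have [bg ga] := Vg n.
have bc (r : R) : bmeas (fun _ : borel T => r) by exact: bmeas_cst.
have b1 : bmeas (fun x => g_ n x + e' * 1) by apply: bmeasD.
have b2 : bmeas (fun x => f' x + e' * 1) by apply: bmeasD.
have := @bmeas_le_Rintegral_on _ _ _ a _ _ _ (measurable_msupport a)
  (msupportC_null hT a) bf b1.
have := @bmeas_le_Rintegral_on _ _ _ a' _ _ _ (measurable_msupport a')
  (msupportC_null hT a') bg b2.
rewrite !bmeas_RintegralD//; try exact: bmeasZ.
rewrite !bmeas_RintegralZ// m' -/m (ga _ _ aa').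
move=> /(_ _)/Wrap[x sx|le1]; first by rewrite mulr1 ltW// g_le.
move=> /(_ _)/Wrap[x sx|le2]; first by rewrite mulr1 ltW// f_le.
by lra.
Qed.

End competitors.

Lemma bmeas_finite_support d (T : measurableType d) (R : realType)
    (f : T -> R) (S : set T) : measurable_fun [set: T] f -> measurable S ->
  finite_set S -> bmeas (fun x => f x * \1_S x).
Proof.
move=> mf mS fS; split.
  by apply: measurable_funM => //; exact: measurable_indic.
have [n fn] : exists n : nat, forall x, S x -> `|f x| <= n%:R.
  have H x : S x -> \forall n \near \oo, `|f x| <= n%:R.
    by move=> _; exact: nbhs_infty_ger.
  have [n _ nf] : \forall n \near \oo, forall x, S x -> `|f x| <= n%:R.
    exact: near_finite_set fS H.
  by exists n; exact: nf n (leqnn n).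
exists n%:R => x; rewrite indicE; have [/set_mem Sx|_] := boolP (x \in S).
  by rewrite mulr1 fn.
by rewrite mulr0 normr0.
Qed.

Lemma admissible_family_bmeas (R : realType) (T : ptopologicalType)
  (F : set (T -> R)) : admissible_family F ->
  forall f, F f -> bmeas (f : borel T -> R).
Proof.
move=> [FC|[_ FB]] f Ff.
- have [cf bf] := FC f Ff; apply: bmeas_bounded => //.
  exact: continuous_borel_measurable.
- by have [mf bf] := FB f Ff; exact: bmeas_bounded.
Qed.

Lemma RN_version_gt0 (R : realType) (T : ptopologicalType)
    (P Q : probability (borel T) R) (D : borel T -> R) :
  Q `<< P -> RN_version P Q D -> Q [set x | D x <= 0] = 0%E.
Proof.
move=> QP [mD D0 DRN].
have mA : measurable [set x | D x <= 0].
  by rewrite -[X in measurable X]setTI; exact: measurable_fun_ler.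
rewrite (Radon_Nikodym_measure QP mD DRN mA).
by apply: integral0_eq => x /= Dx; congr EFin; apply/le_anti; rewrite Dx D0.
Qed.

(** * Integrals of the extended derivative *)

Section ederive_integral.
Context {R : realType} {T : ptopologicalType}.
Hypothesis hT : polish_space R T.
Variable h : R -> R.
Hypothesis h_diff2 : forall x, 0 < x -> derivable (derive1 h) x 1.
Hypothesis h'0_lty : (ederive h 0 < +oo)%E.
Variable D : borel T -> R.
Hypothesis mD : measurable_fun [set: borel T] D.
Hypothesis D0 : forall x, 0 <= D x.

Let theta x := ederive h (D x).

Lemma measurable_ederive : measurable_fun [set: borel T] theta.
Proof.
rewrite [X in measurable_fun _ X](_ : _ = fun x =>
    if 0 < D x then (derive1_at0 h 0 (D x))%:E else ederive h 0).
  apply: measurable_fun_ifT => //; first exact: measurable_fun_ltr.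
  by apply/measurable_EFinP/(measurableT_comp (measurable_derive1_at0 h_diff2 0)).
apply/funext => x; have := D0 x; rewrite le_eqVlt => /predU1P[Dx|Dx].
  by rewrite /theta -Dx ltxx.
by rewrite Dx /theta /ederive gt_eqF// /derive1_at0 Dx.
Qed.

Lemma ederive_gt0 c x : 0 < D x -> theta x = (derive1_at0 h c (D x))%:E.
Proof. by move=> Dx; rewrite /theta /ederive gt_eqF// /derive1_at0 Dx. Qed.

(* Competitor measures charging the set where [D] vanishes are ruled out when
   [ederive h 0 = -oo]: the inequality for all [c] then fails as [c --> -oo]. *)
Lemma le_integral_ederive (a a' : {finite_measure set (borel T) -> \bar R})
    (c_ : nat -> R) :
  finite_set (msupport a) -> finite_set (msupport a') ->
  c_ = (fun n => if ederive h 0 is r%:E then r else - n%:R) ->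
  (forall x, msupport a x -> 0 < D x) ->
  (forall n (f : borel T -> R), bmeas f ->
    (forall x, (msupport a `|` msupport a') x ->
      f x = derive1_at0 h (c_ n) (D x)) ->
    \int[a]_x f x <= \int[a']_x f x) ->
  (\int[a]_x theta x <= \int[a']_x theta x)%E.
Proof.
move=> fa fa' cE Da H.
pose U : set (borel T) := msupport a `|` msupport a'.
have mU : measurable U by apply: measurableU; exact: measurable_msupport.
have fU : finite_set U by rewrite finite_setU.
have U1 x : U x -> \1_U x = 1 :> R by move=> Ux; rewrite indicE mem_set.
pose psi n x := derive1_at0 h (c_ n) (D x) * \1_U x.
have bpsi n : bmeas (psi n).
  apply: bmeas_finite_support => //.
  exact: (measurableT_comp (measurable_derive1_at0 h_diff2 (c_ n))).
have Hpsi n : \int[a]_x psi n x <= \int[a']_x psi n x.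
  by apply: (H n) => // x Ux; rewrite /psi U1// mulr1.
have aE n : (\int[a]_x theta x = \int[a]_x (psi n x)%:E)%E.
  apply: ae_eq_integral => //; first exact: measurable_ederive.
    by apply/measurable_EFinP; case: (bpsi n).
  exists (~` msupport a); split.
  - by apply: measurableC; exact: measurable_msupport.
  - exact: msupportC_null.
  - apply: subsetC => x ax _.
    by rewrite (ederive_gt0 (c_ n))?Da// /psi U1 ?mulr1//; left.
have a'E n (B : set (borel T)) : measurable B -> a' B = 0%E ->
    (forall x, msupport a' x -> ~ B x -> theta x = (derive1_at0 h (c_ n) (D x))%:E) ->
    (\int[a']_x theta x = \int[a']_x (psi n x)%:E)%E.
  move=> mB B0 Btheta; apply: ae_eq_integral => //; first exact: measurable_ederive.
    by apply/measurable_EFinP; case: (bpsi n).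
  exists (~` msupport a' `|` B); split.
  - apply: measurableU => //.
    by apply: measurableC; exact: measurable_msupport.
  - rewrite measureU0 ?msupportC_null//.
    by apply: measurableC; exact: measurable_msupport.
  - move=> x /= /not_implyP[_ xpsi].
    have [Bx|nBx] := pselect (B x); [by right|left=> a'x].
    by apply: xpsi; rewrite (Btheta x)// /psi U1 ?mulr1//; right.
(* The set [B] carries the possible discrepancy between [theta] and its real stand-in: it is empty
   when the derivative at 0 is finite, and otherwise the part of the supports where [D] vanishes. *)
suff [B [mB B0 Btheta]] : exists B : set (borel T), [/\ measurable B, a' B = 0%E &
    forall x, msupport a' x -> ~ B x ->
      theta x = (derive1_at0 h (c_ 0%N) (D x))%:E].
  rewrite (aE 0%N) (a'E 0%N B)// -!EFin_Rintegral// lee_fin.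
  exact: Hpsi.
case h0 : (ederive h 0) h'0_lty => [r||]// _.
  exists set0; split => // x _ _; have := D0 x.
  rewrite le_eqVlt => /predU1P[Dx|]; last exact: ederive_gt0.
  by rewrite /theta -Dx h0 /derive1_at0 ltxx cE h0.
pose B := U `&` [set x | D x <= 0].
have mB : measurable B.
  apply: measurableI => //.
  by rewrite -[X in measurable X]setTI; exact: measurable_fun_ler.
exists B; split => //; last first.
  move=> x a'x xB; apply: ederive_gt0; rewrite ltNge; apply/negP => Dx.
  by apply: xB; split => //; right.
have b1B : bmeas (\1_B : borel T -> R).
  split; first exact: measurable_indic.
  by exists 1 => x; rewrite indicE normr_nat lern1 leq_b1.
have a'B : a' B \is a fin_num by exact: fin_num_measure.
(* Passing from [c_ 0] to [c_ n] lowers the [a'] integral by [n] times the mass of [B] and leaves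
   the [a] integral unchanged, as [D > 0] on the support of [a]. A bound uniform in [n] forces this
   mass to be zero. *)
have B_le n : n%:R * fine (a' B) <= \int[a']_x psi 0%N x - \int[a]_x psi 0%N x.
  have -> : fine (a' B) = \int[a']_x \1_B x.
    by rewrite /Rintegral integral_indic// setIT.
  rewrite lerBrDl -lerBrDr -bmeas_RintegralZ// -bmeas_RintegralB//; last exact: bmeasZ.
  have -> : \int[a']_x (psi 0%N x - n%:R * \1_B x) = \int[a']_x psi n x.
    apply: eq_Rintegral => x _; rewrite /psi /B indicI/= cE h0 /derive1_at0.
    rewrite [\1_[set y | D y <= 0] x]indicE.
    have -> : (x \in [set y | D y <= 0]) = (D x <= 0).
      by apply/idP/idP => [/set_mem//|Dx]; rewrite mem_set.
    case: ltP => Dx /=; ring.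
  apply: le_trans (Hpsi n).
  by rewrite -lee_fin !EFin_Rintegral// -!aE.
rewrite -(fineK a'B); congr EFin; apply/le_anti; rewrite fine_ge0// andbT leNgt.
apply/negP => B0.
set I := \int[a']_x psi 0%N x - \int[a]_x psi 0%N x in B_le.
have := B_le (Num.bound `|I / fine (a' B)|); rewrite -ler_pdivlMr//.
by rewrite leNgt (le_lt_trans (ler_norm _))// archi_boundP.
Qed.

End ederive_integral.

(** * Exceptional sets and the inequality for competitors *)

Unset Implicit Arguments.

Theorem lemma1p3 (R : realType) (T : ptopologicalType)
  (hT : polish_space R T)
  (P : probability (borel T) R)
  (F : set (T -> R)) (hF : admissible_family F)
  (h : R -> R)
  (h_ge0 : forall x, 0 <= x -> 0 <= h x)
  (h_cont : {within `[0, +oo[, continuous h})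
  (h_diff : forall x, 0 < x -> derivable h x 1)
  (h'0_cvg : cvg ((derive1 h x)%:E @[x --> 0^'+]))
  (h'0_lty : (ederive h 0 < +oo)%E)
  (h_diff2 : forall x, 0 < x -> derivable (derive1 h) x 1)
  (C : R) (h''_ge : forall x, 0 < x -> C <= derive1n 2 h x)
  (h'_pinfty : derive1 h x @[x --> +oo] --> +oo)
  (h'_alt : (exists m : R, forall x, 0 < x -> m <= derive1 h x) \/
            (derive1 h x @[x --> 0^'+] --> -oo))
  (Qs : probability (borel T) R)
  (Qs_opt : optimizer h P F Qs)
  (Qs_fin : (Gh h P Qs < +oo)%E)
  (D : T -> R) (hD : RN_version P Qs D) :
  exists GQ GP : set (borel T),
    [/\ measurable GQ, measurable GP, P GP = 1%E, Qs GQ = 1%E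
      & forall a a' : {finite_measure set (borel T) -> \bar R},
          competitors F a a' ->
          msupport a `<=` GQ -> msupport a' `<=` GP ->
          (\int[a]_x ederive h (D x) <= \int[a']_x ederive h (D x))%E].
Proof.
have [mD D0 _] := hD; have QP := optimizer_dominates Qs_fin.
pose c_ (n : nat) := if ederive h 0 is r%:E then r else - n%:R.
have h'0_le n : (ederive h 0 <= (c_ n)%:E)%E.
  by rewrite /c_; case: (ederive h 0) h'0_lty => [r||]//; rewrite leNye.
have /choice[g g_P] n : exists g_ : nat -> borel T -> R,
    (forall m, competitor_invariant F (g_ m)) /\
    {ae P, forall x, forall e, 0 < e ->
      (\forall m \near \oo, g_ m x < derive1_at0 h (c_ n) (D x) + e) /\
      (0 < D x -> \forall m \near \oo, derive1_at0 h (c_ n) (D x) < g_ m x + e)}.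
  have [g_ Vg aeg] := optimizer_ae_approximation (admissible_family_bmeas hF)
    h_ge0 h_cont h_diff h'0_cvg h_diff2 h''_ge Qs_opt Qs_fin hD (h'0_le n).
  by exists g_.
(* Countably many constants [c_ n] suffice, so a single null set serves all the approximations. *)
have [Z [mZ PZ0 Zg]] := ae_foralln (fun n => (g_P n).2).
have Zg' x : ~ Z x -> forall n e, 0 < e ->
    (\forall m \near \oo, g n m x < derive1_at0 h (c_ n) (D x) + e) /\
    (0 < D x -> \forall m \near \oo, derive1_at0 h (c_ n) (D x) < g n m x + e).
  by move=> nZ n; move: nZ; apply: contra_notP => /= H; apply: Zg => /= /(_ n).
have mDle : measurable [set x : borel T | D x <= 0].
  by rewrite -[X in measurable X]setTI; exact: measurable_fun_ler.
(* The approximation from above holds off [Z]; the one from below also requires [0 < D x], which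
   costs only a null set for [Qs]. *)
exists (~` (Z `|` [set x | D x <= 0])), (~` Z); split.
- by apply: measurableC; exact: measurableU.
- exact: measurableC.
- by rewrite probability_setC// PZ0 sube0.
- rewrite probability_setC; last exact: measurableU.
  rewrite (measureU0 mZ mDle); last exact: RN_version_gt0 QP hD.
  suff QZ0 : Qs Z = 0%E by rewrite [X in (1 - X)%E]QZ0 sube0.
  by move/null_content_dominatesP : QP => /(_ Z mZ PZ0).
move=> a a' aa' aG a'G; have [_ fa fa' _] := aa'.
have Da x : msupport a x -> 0 < D x.
  by move=> /aG /= /not_orP[_ /negP]; rewrite -ltNge.
apply: (@le_integral_ederive _ _ hT h h_diff2 h'0_lty D mD D0 a a' c_) => //.
move=> n f bf fE; apply: (@competitors_le _ _ hT _ _ _ aa' (g n)) => //.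
- by have [] := g_P n.
- move=> x ax e e0; rewrite fE; last by left.
  have /not_orP[xZ _] := aG _ ax.
  by have [_] := Zg' _ xZ n e e0; apply; exact: Da.
- move=> x a'x e e0; rewrite fE; last by right.
  by have [+ _] := Zg' _ (a'G _ a'x) n e e0.
Qed.
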